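(* Let $0<q<\tfrac12$, $p:=1-q$ (so $p>q$), and let $\{S_n\}_{n\ge 0}$ be the one-dimensional simple random walk started from $S_0=0$ with $\mathbf{P}(S_{n+1}-S_n=1)=p$ and $\mathbf{P}(S_{n+1}-S_n=-1)=q$. Let $\mathcal{K}(n)$ denote its set of favorite sites at time $n$. Then, almost surely, $$\limsup_{n\to\infty}\frac{\#\mathcal{K}(n)}{\log\log n}=-\frac{1}{\log(1-2q)} .$$
   Context: Let $X_1,X_2,\ldots$ be i.i.d. with $\mathbf{P}(X_1=1)=p$, $\mathbf{P}(X_1=-1)=q=1-p$, and $S_0=0$, $S_n=X_1+\cdots+X_n$ for $n\ge1$. For $z\in\mathbb{Z}$ and $n\ge 1$, the local time at $z$ up to time $n$ is $\xi(z,n):=\#\{k: 0<k\le n,\ S_k=z\}$, and $\xi(n):=\max_{y\in\mathbb{Z}}\xi(y,n)$. The set of favorite sites at time $n$ is $\mathcal{K}(n):=\{z\in\mathbb{Z}: \xi(z,n)=\xi(n)\}$. Here $\#D$ denotes the cardinality of $D$. *)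

(* Defs.v *)
From HB Require Import structures.
From mathcomp Require Import all_boot all_order all_algebra finmap.
From mathcomp Require Import all_classical all_reals all_analysis.

Set Implicit Arguments.
Unset Strict Implicit.
Unset Printing Implicit Defensive.

Import Order.TTheory GRing.Theory Num.Theory.

Local Open Scope classical_set_scope.
Local Open Scope ring_scope.

Definition mutually_independent (d : measure_display) (T : measurableType d)
    (R : realType) (P : probability T R) (I : choiceType)
    (X : I -> {RV P >-> R}) : Prop :=
  forall (J : {fset I}) (A : I -> set R),
    (forall i, i \in J -> measurable (A i)) ->
    P (\bigcap_(i in [set` J]) X i @^-1` A i) =
    (\prod_(i <- J) P (X i @^-1` A i))%E.

(* The laws are compared on measurable sets only: the value of a measure on a
   non-measurable set carries no information. *)
Definition identically_distributed (d : measure_display) (T : measurableType d)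
    (R : realType) (P : probability T R) (I : choiceType)
    (X : I -> {RV P >-> R}) : Prop :=
  forall (i j : I) (A : set R), measurable A ->
    distribution P (X i) A = distribution P (X j) A.

(* The increments are numbered from 0, so that X k stands for X_{k+1}. *)
Definition walk (d : measure_display) (T : measurableType d) (R : realType)
    (P : probability T R) (X : nat -> {RV P >-> R}) (w : T) (n : nat) : R :=
  \sum_(k < n) X k w.

Section favorite_sites.
Variables (R : realType) (s : nat -> R).

Definition local_time (z : int) (n : nat) : nat :=
  #|[pred k : 'I_n.+1 | (0 < k)%N && (s k == z%:~R)]|.

(* The big operator runs over the finitely many y with nonzero local time;
   local_time_le_max and max_local_time_attained say that its value is the
   maximum over all y. *)
Definition max_local_time (n : nat) : nat :=
  \big[maxn/0%N]_(y \in [set: int]) local_time y n.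

Definition favorite_sites (n : nat) : set int :=
  [set z | local_time z n = max_local_time n].

Lemma local_time_support_finite (n : nat) :
  finite_set ([set: int] `&` (local_time ^~ n) @^-1` [set~ 0%N]).
Proof.
apply: (@sub_finite_set _ _ ((fun k => Num.floor (s k)) @` `I_n.+1)).
  move=> y [_ /= /eqP]; rewrite -lt0n => /card_gt0P[k].
  rewrite inE => /andP[_ /eqP sk]; exists (k : nat) => //=.
  by rewrite sk intrKfloor.
exact/finite_image/finite_II.
Qed.

Lemma local_time_le_max (y : int) (n : nat) :
  (local_time y n <= max_local_time n)%N.
Proof.
have [->//|y0] := eqVneq (local_time y n) 0%N.
apply: (@leq_bigmax_seq _ _ xpredT (local_time ^~ n)) => //.
rewrite in_finite_support; last exact: local_time_support_finite.
by rewrite inE; split => //=; apply/eqP.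
Qed.

Lemma max_local_time_attained (n : nat) :
  exists z : int, local_time z n = max_local_time n.
Proof.
have [m0|] // : max_local_time n = 0%N \/
    exists z : int, local_time z n = max_local_time n.
  rewrite /max_local_time.
  apply: (big_ind (fun m => m = 0%N \/ exists z, local_time z n = m)).
  - by left.
  - by move=> a b ha hb; case: (leqP a b).
  - by move=> i _; right; exists i.
exists 0; apply/eqP; rewrite m0 -leqn0 -m0; exact: local_time_le_max.
Qed.

(* The cardinal #|` fset_set A| is 0 when A is infinite; this lemma shows that
   favorite_sites is finite as soon as the path has visited an integer. *)
Lemma favorite_sites_finite (n : nat) :
  (0 < max_local_time n)%N -> finite_set (favorite_sites n).
Proof.
move=> m0; apply: sub_finite_set (local_time_support_finite n).
by move=> z /= zm; split => //=; apply/eqP; rewrite zm -lt0n.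
Qed.

End favorite_sites.

(* Main.v *)
Require Import Defs.
From HB Require Import structures.
From mathcomp Require Import all_boot all_order all_algebra finmap.
From mathcomp Require Import all_classical all_reals all_analysis.
From mathcomp Require Import ring lra zify.

(** Write g = 1 - 2q for the probability that the walk never returns to its
    current site.  Once the maximal local time is m, every site that reaches
    level m remains a favorite until it is visited again, so the number of
    favorites seen at level m is roughly geometric with parameter g.  About
    log n levels are reached up to time n, hence the order
    log log n / (- log g).

    Upper bound: two sites at bounded distance both reach level m with a
    probability exponentially smaller than (2q)^m, so eventually the favorites
    are D-separated; then a new favorite can only appear after the walk has
    moved D away from the previous one without returning to it, which has a
    probability close to g for large D.

    Lower bound: a walk that never returns to a site stays to the right of it,
    so with probability at least g the next site to reach level m does so
    before the previous one is revisited, and lies to its right.  Given the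
    past, level m thus produces k + 1 favorites with probability at least g^k,
    so the probability of a failure at every level is bounded by a product,
    which tends to 0 when g^k is at least 1/m at level m.

    All this is done by exhibiting super- and submartingales on finite
    histories of the walk; the probability space only enters through the law
    of a history and the Borel-Cantelli lemma. *)

Set Implicit Arguments.
Unset Strict Implicit.
Unset Printing Implicit Defensive.

Import Order.TTheory GRing.Theory Num.Theory.

Local Open Scope classical_set_scope.
Local Open Scope ring_scope.

(** * Histories of the walk *)

(* A history lists the positions S_n, ..., S_1, most recent first; S_0 is left
   out because the local times do not count time 0. *)
Definition pos (h : seq int) : int := head 0 h.
Definition up (h : seq int) : seq int := (pos h + 1) :: h.
Definition down (h : seq int) : seq int := (pos h - 1) :: h.

Fixpoint top (h : seq int) : nat :=
  if h is y :: h' then maxn (top h') (count_mem y h') .+1 else 0%N.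

(* Number of sites with local time at least [m] (for [m > 0]): each of them is
   counted when its local time becomes [m]. *)
Fixpoint nreach (m : nat) (h : seq int) : nat :=
  if h is y :: h' then (nreach m h' + ((count_mem y h').+1 == m))%N else 0%N.

(** The default 0 is never consulted: the value only matters once [nreach m h > 0]. *)
Fixpoint last_reach (m : nat) (h : seq int) : int :=
  if h is y :: h' then
    if (count_mem y h').+1 == m then y else last_reach m h'
  else 0.

(** The test on [nreach] keeps the default 0 out of the maximum. *)
Fixpoint right_reach (m : nat) (h : seq int) : int :=
  if h is y :: h' then
    if (count_mem y h').+1 == m then
      if nreach m h' == 0%N then y else Num.max (right_reach m h') y
    else right_reach m h'
  else 0.

Definition close (D m : nat) (h : seq int) : bool :=
  has (fun z => has (fun z' => [&& z != z', (absz (z - z') < D)%N,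
    (m <= count_mem z h)%N & (m <= count_mem z' h)%N]) h) h.

(** The suffixes of a history are the earlier histories, so this looks back over the whole past, the
    empty history included. *)
Fixpoint ever (A : pred (seq int)) (h : seq int) : bool :=
  A h || (if h is _ :: h' then ever A h' else false).

Section Expectation.
Variables (R : realFieldType) (p q : R).

(** Conditional expectation of [F] after [n] more steps, given the past [h]. *)
Fixpoint expect (n : nat) (F : seq int -> R) (h : seq int) : R :=
  if n is n'.+1 then p * expect n' F (up h) + q * expect n' F (down h)
  else F h.

End Expectation.

(** * Local times and levels of a history *)

Lemma count_le_top z h : (count_mem z h <= top h)%N.
Proof.
elim: h => //= y h IH; case: eqVneq => [->|_] /=.
  by rewrite add1n leq_max leqnn orbT.
by rewrite add0n (leq_trans IH) // leq_maxl.
Qed.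

Lemma top_attained h : (0 < top h)%N -> exists2 z, z \in h & count_mem z h = top h.
Proof.
elim: h => //= y h IH _.
case: (leqP (top h) (count_mem y h).+1) => [le|lt].
  by exists y; rewrite ?mem_head // eqxx add1n.
have [z zh zt] := IH (leq_ltn_trans (leq0n _) lt).
exists z; first by rewrite inE zh orbT.
have yz : y != z by apply: contraTneq lt => ->; rewrite zt ltnNge leqnSn.
by rewrite (negbTE yz) add0n zt.
Qed.

Lemma top_cons_le y h : (top (y :: h) <= (top h).+1)%N.
Proof. by rewrite /= geq_max leqnSn ltnS count_le_top. Qed.

Lemma top_cons_ge y h : (top h <= top (y :: h))%N.
Proof. exact: leq_maxl. Qed.

(** Prepending y raises the local time of y alone, by one, so a site is gained exactly when that
    local time becomes m. A first visit is treated apart, since it also enlarges [undup h]. *)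
Lemma nreachE m h : (0 < m)%N ->
  nreach m h = size [seq z <- undup h | (m <= count_mem z h)%N].
Proof.
move=> m0; elim: h => //= y h IH; rewrite IH.
transitivity (size [seq z <- undup h | (m <= (y == z) + count_mem z h)%N] +
   ((y \notin h) && (m == 1%N)))%N; last first.
  case: (boolP (y \in h)) => yh /=; first by rewrite addn0.
  rewrite eqxx add1n (count_memPn yh).
  have -> : (m <= 1)%N = (m == 1%N) by case: m m0 {IH} => [|[|]].
  by case: (m == 1%N) => //=; rewrite ?addn1 ?addn0.
rewrite !size_filter.
case: (boolP (y \in h)) => yh /=; last first.
  rewrite (count_memPn yh) eq_sym; congr (_ + _)%N.
  apply: eq_in_count => z; rewrite mem_undup.
  by case: eqVneq => [<-|] //; rewrite (negbTE yh).
rewrite addn0.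
have cu (a : pred int) : count a (undup h) = (a y + count a (rem y (undup h)))%N.
  have yu : y \in undup h by rewrite mem_undup.
  by have /seq.permP -> := perm_to_rem yu.
rewrite !cu eqxx add1n.
have -> : count (fun z => (m <= (y == z) + count_mem z h)%N) (rem y (undup h)) =
          count (fun z => (m <= count_mem z h)%N) (rem y (undup h)).
  apply: eq_in_count => z; rewrite mem_rem_uniq ?undup_uniq // !inE.
  by case/andP => /negbTE; rewrite eq_sym => ->.
move: (count _ (rem _ _)) (count_mem y h) => a b.
by do 2 case: leqP; case: eqP; lia.
Qed.

Lemma nreach_eq0 m h : (top h < m)%N -> nreach m h = 0%N.
Proof.
elim: h => //= y h IH; rewrite gtn_max => /andP[h1 h2].
by rewrite IH // add0n; lia.
Qed.

Lemma nreach_gt0 m h : (0 < m <= top h)%N -> (0 < nreach m h)%N.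
Proof.
case/andP=> m0; elim: h => [|y h IH] /=; first by rewrite leqn0; case: m m0.
case: (leqP m (top h)) => [/IH|lt]; first by rewrite addn_gt0 => ->.
rewrite leq_max leqNgt lt /= => mc.
have -> : (count_mem y h).+1 == m.
  by rewrite eqn_leq mc (leq_trans _ lt) // ltnS count_le_top.
by rewrite addn1.
Qed.

Lemma last_reach_count m h : (0 < nreach m h)%N ->
  (m <= count_mem (last_reach m h) h)%N.
Proof.
elim: h => //= y h IH; case: eqP => [<-|_] /=; first by rewrite eqxx add1n.
by rewrite addn0 => /IH/leq_trans; apply; rewrite leq_addl.
Qed.

Lemma right_reach_ge m h y : (0 < m <= count_mem y h)%N -> y <= right_reach m h.
Proof.
case/andP=> m0; elim: h => [|x h IH] /=; first by rewrite leqn0; case: m m0.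
case: (leqP m (count_mem y h)) => [my _|lt].
  have n0 : (0 < nreach m h)%N.
    by rewrite nreach_gt0 // m0 (leq_trans my) ?count_le_top.
  by case: eqP => _; rewrite ?gtn_eqF // ?le_max; rewrite (IH my).
case: (eqVneq x y) => [->|_]; last by rewrite add0n leqNgt lt.
rewrite add1n => mc; have -> : (count_mem y h).+1 == m by rewrite eqn_leq lt mc.
by case: eqP => // _; rewrite le_max lexx orbT.
Qed.

Lemma close_cons D m y h : close D m h -> close D m (y :: h).
Proof.
case/hasP => z zh /hasP[z' z'h /and4P[zz d c c']].
apply/hasP; exists z; first by rewrite inE zh orbT.
apply/hasP; exists z'; first by rewrite inE z'h orbT.
by rewrite zz d /= (leq_trans c) ?(leq_trans c') ?leq_addl.
Qed.

Lemma close_intro D m y z h : (0 < m)%N -> y != z -> (absz (y - z) < D)%N ->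
  (m <= count_mem y h)%N -> (m <= count_mem z h)%N -> close D m h.
Proof.
move=> m0 yz d c c'.
have mem x : (m <= count_mem x h)%N -> x \in h.
  by move=> mx; rewrite -has_pred1 has_count (leq_trans m0 mx).
apply/hasP; exists y; first exact: mem.
by apply/hasP; exists z; [exact: mem|apply/and4P].
Qed.

Lemma ever_catr A h1 h2 : ever A h2 -> ever A (h1 ++ h2).
Proof. by move=> e; elim: h1 => //= y h1 ->; rewrite orbT. Qed.

Lemma ever_here (A : pred (seq int)) h : A h -> ever A h.
Proof. by case: h => [|y h] /= ->. Qed.

(** * Expectations over the continuations of a history *)

Section ExpectationTheory.
Variables (R : realFieldType) (p q : R).
Hypotheses (p0 : 0 <= p) (q0 : 0 <= q) (pq1 : p + q = 1).
Local Notation E := (expect p q).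

Lemma expect_le n F G h : (forall h, F h <= G h) -> E n F h <= E n G h.
Proof.
move=> FG; elim: n h => [|n IH] h //=.
by apply: lerD; apply: ler_wpM2l.
Qed.

Lemma expect_cst n c h : E n (fun=> c) h = c.
Proof. by elim: n h => //= n IH h; rewrite !IH -mulrDl pq1 mul1r. Qed.

Lemma expect_ge0 n F h : (forall h, 0 <= F h) -> 0 <= E n F h.
Proof. by move=> F0; rewrite -{1}(expect_cst n 0 h); apply: expect_le. Qed.

Lemma expect_le1 n F h : (forall h, F h <= 1) -> E n F h <= 1.
Proof. by move=> F1; rewrite -[leRHS](expect_cst n 1 h); apply: expect_le. Qed.

Lemma expectZ n c F h : E n (fun h => c * F h) h = c * E n F h.
Proof. by elim: n h => //= n IH h; rewrite !IH; ring. Qed.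

Lemma expectD n F G h : E n (fun h => F h + G h) h = E n F h + E n G h.
Proof. by elim: n h => //= n IH h; rewrite !IH; ring. Qed.

Lemma expect_sum n (I : Type) (r : seq I) F h :
  E n (fun h => \sum_(i <- r) F i h) h = \sum_(i <- r) E n (F i) h.
Proof.
elim: n h => //= n IH h; rewrite !IH.
by rewrite [RHS]big_split /= !mulr_sumr.
Qed.

Lemma expect_expect n k F h : E (n + k) F h = E n (E k F) h.
Proof. by elim: n h => //= n IH h; rewrite !IH. Qed.

(* Optional stopping at the first time when [A] holds. *)
Lemma expect_ever_le (A : pred (seq int)) (V : seq int -> R) n h :
  (forall h, 0 <= V h) -> (forall h, A h -> 1 <= V h) ->
  (forall h, ~~ A h -> p * V (up h) + q * V (down h) <= V h) ->
  (ever A h -> A h) -> E n (fun h => (ever A h)%:R) h <= V h.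
Proof.
move=> V0 V1 VS.
elim: n h => [|n IH] h eA /=; have [Ah|Ah] := boolP (A h).
- by case: (ever A h); rewrite ?V1.
- by rewrite (negbTE (contra eA Ah)) V0.
- by apply: le_trans (V1 _ Ah); apply: (@expect_le1 n.+1) => ?; case: ever.
- apply: le_trans (VS _ Ah); apply: lerD; apply: ler_wpM2l => //; apply: IH;
    by rewrite /= (negbTE (contra eA Ah)) orbF.
Qed.

End ExpectationTheory.

(** * Hitting and return probabilities *)

Section Intpow.
Variable R : realFieldType.

Lemma exprz_itv (b : R) (x : int) : 0 < b < 1 -> 0 <= x -> 0 < b ^ x <= 1.
Proof.
move=> /andP[b0 b1]; case: x => // n _.
by rewrite exprz_gt0 // exprn_ile1 // ltW.
Qed.

Lemma exprz_ge1 (b : R) (x : int) : 0 < b < 1 -> x <= 0 -> 1 <= b ^ x.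
Proof.
move=> b01 x0; have b0 : 0 < b by case/andP: b01.
have /andP[y0 y1] : 0 < b ^ (- x) <= 1 by rewrite exprz_itv // oppr_ge0.
by rewrite -[x]opprK -invr_expz invf_ge1.
Qed.

End Intpow.

Section Kernels.
Variables (R : rcfType) (q : R).
Hypotheses (q0 : 0 < q) (q2 : 2 * q < 1).
Let p := 1 - q.
Let b := q / p.
Local Notation E := (expect p q).

Let p0 : 0 < p. Proof. by have h := q2; have h' := q0; rewrite /p; lra. Qed.
Let b01 : 0 < b < 1.
Proof.
by have h := q2; rewrite /b divr_gt0 // ltr_pdivrMr // mul1r /p; lra.
Qed.
Let bq : b < 2 * q.
Proof.
by have h := q2; have h' := q0; rewrite /b ltr_pdivrMr // /p; nra.
Qed.
Let bN0 : b != 0. Proof. by rewrite gt_eqF //; case/andP: b01. Qed.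
Let pb : p * b = q. Proof. by rewrite /b mulrCA divff ?mulr1 // gt_eqF. Qed.
Let qb : q / b = p. Proof. by rewrite /b invf_div mulrCA divff ?mulr1 // gt_eqF. Qed.

Definition step_avg (f : int -> R) (x : int) := p * f (x + 1) + q * f (x - 1).

(** Harmonicity comes from p b + q / b = q + p = 1. *)
Lemma avg_exprz x : step_avg (fun x => b ^ x) x = b ^ x.
Proof.
rewrite /step_avg !expfzDr // expr1z -[b ^ -1]/(b^-1).
by rewrite [p * _]mulrCA [q * _]mulrCA pb qb -mulrDr /p addrC subrK mulr1.
Qed.

(** Gambler's ruin: the probability that the walk started at x ever visits 0. *)
Definition hit_prob (x : int) : R := if 0 <= x then b ^ x else 1.

Lemma hit_prob_itv x : 0 <= hit_prob x <= 1.
Proof.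
rewrite /hit_prob; case: ifP => [x0|]; last by rewrite ler01 lexx.
by case/andP: (exprz_itv b01 x0) => /ltW -> ->.
Qed.

Lemma hit_prob0 : hit_prob 0 = 1. Proof. by []. Qed.

Lemma avg_hit_prob x : x != 0 -> step_avg hit_prob x = hit_prob x.
Proof.
move=> x0; rewrite {2}/hit_prob; case: ifP => h.
  rewrite -[RHS]avg_exprz /step_avg /hit_prob.
  by rewrite !ifT //; lia.
rewrite /step_avg /hit_prob; case: ifP => h1.
  have -> : x + 1 = 0 by lia.
  by rewrite ifF; [rewrite /p expr0z; ring|lia].
by rewrite ifF; [rewrite /p; ring|lia].
Qed.

Lemma avg_hit_prob0 : step_avg hit_prob 0 = 2 * q.
Proof. by rewrite /step_avg /hit_prob /= expr1z pb mulr1; ring. Qed.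

Definition sqrtb := Num.sqrt b.
(** This is 2 sqrt(pq), the eigenvalue of [step_avg] on the powers of [sqrtb]; being below 1, it
    controls the tail of the hitting times. *)
Definition decay := 2 * q / sqrtb.

Let sqrtb2 : sqrtb * sqrtb = b.
Proof. by rewrite -expr2 sqr_sqrtr // ltW //; case/andP: b01. Qed.
Let sqrtb01 : 0 < sqrtb < 1.
Proof.
case/andP: b01 => b0 b1; rewrite sqrtr_gt0 b0 -sqrtr1 ltr_sqrt ?ltr01 //.
Qed.

Lemma decay_gt0 : 0 < decay.
Proof. by case/andP: sqrtb01 => m0 _; rewrite divr_gt0 // mulr_gt0. Qed.

Lemma decay_lt1 : decay < 1.
Proof.
case/andP: sqrtb01 => m0 _; rewrite /decay ltr_pdivrMr // mul1r.
(* Equivalent to 4pq < 1, that is (1 - 2q)^2 > 0. *)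
have h : 4 * q * q < sqrtb * sqrtb.
  have h := q2; have h' := q0.
  rewrite sqrtb2 /b ltr_pdivlMr // /p.
  have : 0 < (1 - 2 * q) ^+ 2 by rewrite exprn_gt0 // subr_gt0.
  by nra.
have h' := q0; nra.
Qed.

Lemma avg_sqrtb x : step_avg (fun x => sqrtb ^ x) x = decay * sqrtb ^ x.
Proof.
have m0 : sqrtb != 0 by rewrite gt_eqF //; case/andP: sqrtb01.
rewrite /step_avg !expfzDr // expr1z -[sqrtb ^ -1]/(sqrtb^-1).
have -> : decay = p * sqrtb + q / sqrtb.
  apply: (mulIf m0); rewrite /decay divfK //.
  rewrite [RHS]mulrDl divfK // -[p * _ * _]mulrA sqrtb2 pb; ring.
ring.
Qed.

(** Makes [hit_within 0] nonpositive, which starts the induction on the number of steps. *)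
Lemma hit_prob_le_sqrtb x : hit_prob x <= sqrtb ^ x.
Proof.
rewrite /hit_prob; case: ifP => x0; last by rewrite exprz_ge1 //; lia.
have -> : b ^ x = sqrtb ^ x * sqrtb ^ x by rewrite -expfzMl sqrtb2.
by case/andP: (exprz_itv sqrtb01 x0) => m0 m1; rewrite ler_piMr // ltW.
Qed.

(* Lower bound for the probability to hit 0 from [x] within [n] steps. *)
Definition hit_within (n : nat) (x : int) : R := hit_prob x - decay ^+ n * sqrtb ^ x.

Lemma avg_hit_within n x :
  step_avg (hit_within n) x = step_avg hit_prob x - decay ^+ n.+1 * sqrtb ^ x.
Proof. by rewrite exprSr -mulrA -avg_sqrtb /step_avg /hit_within; ring. Qed.

Lemma hit_within_le1 n x : hit_within n x <= 1.
Proof.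
apply: (le_trans _ (proj2 (andP (hit_prob_itv x)))).
rewrite /hit_within gerBl mulr_ge0 ?exprn_ge0 ?exprz_ge0 // ltW ?decay_gt0 //.
by case/andP: sqrtb01.
Qed.

Section Returns.
Variable (L : nat).
(** Lower bound for the probability to return to the current site within L + 1 steps: one step, then
    [hit_within L]. *)
Let r := 2 * q - decay ^+ L.+1.
Hypothesis r0 : 0 <= r.
Variables (z : int) (c : nat).
Let F (h : seq int) : R := (c <= count_mem z h)%N%:R.

Let p0' : 0 <= p. Proof. exact: ltW. Qed.
Let q0' : 0 <= q. Proof. exact: ltW. Qed.
Let pq1 : p + q = 1. Proof. by rewrite /p subrK. Qed.
Let EF0 n h : 0 <= E n F h.
Proof. by apply: expect_ge0 => // ?; rewrite /F ler0n. Qed.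

Let F1 n h : (c <= count_mem z h)%N -> 1 <= E n F h.
Proof.
elim: n h => [|n IH] h ch /=; first by rewrite /F ch.
rewrite -[leLHS]pq1 lerD // ler_peMr //; apply: IH;
  by rewrite (leq_trans ch) // leq_addl.
Qed.

(** The walk hits z within n steps, then makes the remaining i returns. Off z, the arrival itself
    supplies one visit, hence the term [pos h != z]. *)
Let hit_step i :
  (forall n h, pos h = z -> (c <= count_mem z h + i)%N ->
     r ^+ i <= E (n + i * L.+1) F h) ->
  forall n h,
    (c <= count_mem z h + i + (pos h != z))%N ->
    r ^+ i * hit_within n (pos h - z) <= E (n + i * L.+1) F h.
Proof.
move=> IH; elim=> [|n IHn] h ch; have [hz|hz] := eqVneq (pos h) z.
- apply: le_trans (IH _ _ hz _); last by rewrite hz eqxx addn0 in ch.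
  by rewrite ler_piMr ?exprn_ge0 // hit_within_le1.
- apply: le_trans (EF0 _ _); rewrite mulr_ge0_le0 ?exprn_ge0 //.
  by rewrite /hit_within expr0 mul1r subr_le0 hit_prob_le_sqrtb.
- apply: le_trans (IH _ _ hz _); last by rewrite hz eqxx addn0 in ch.
  by rewrite ler_piMr ?exprn_ge0 // hit_within_le1.
- have -> : hit_within n.+1 (pos h - z) = step_avg (hit_within n) (pos h - z).
    by rewrite avg_hit_within avg_hit_prob // subr_eq0.
  have step y : (c <= count_mem z (y :: h) + i + (y != z))%N.
    move: ch => /=; rewrite hz.
    by case: (y == z); rewrite /= !(add0n, addn0, addn1, add1n) //; lia.
  rewrite addSn /= /step_avg mulrDr !mulrA ![_ * p]mulrC ![_ * q]mulrC -!mulrA.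
  have -> : pos h - z + 1 = pos (up h) - z by rewrite /= addrAC.
  have -> : pos h - z - 1 = pos (down h) - z by rewrite /= addrAC.
  by apply: lerD; apply: ler_wpM2l => //; apply: IHn; exact: step.
Qed.

(** The missing visits are made by i successive returns of at most L + 1 steps each. The n spare
    steps absorb the time saved by returns that end early. *)
Lemma returns_ge i n h : pos h = z -> (c <= count_mem z h + i)%N ->
  r ^+ i <= E (n + i * L.+1) F h.
Proof.
elim: i n h => [|i IH] n h hz ch.
  by rewrite expr0; apply: F1; rewrite addn0 in ch.
have step y : y != z -> (c <= count_mem z (y :: h) + i + (y != z))%N.
  by move=> yz; rewrite /= yz (negbTE yz) add0n addn1 -addnS.
have -> : (n + i.+1 * L.+1 = (n + L + i * L.+1).+1)%N.
  by rewrite mulSn addnA addnS addSn.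
apply: (@le_trans _ _ (r ^+ i * step_avg (hit_within (n + L)) 0)).
  rewrite avg_hit_within avg_hit_prob0 expr0z mulr1 exprSr ler_wpM2l ?exprn_ge0 //.
  rewrite /r lerD2l lerN2 ler_wiXn2l ?ltW ?decay_gt0 ?decay_lt1 //.
  by rewrite ltnS leq_addl.
rewrite /= /step_avg mulrDr !mulrA ![_ * p]mulrC ![_ * q]mulrC -!mulrA.
have -> : 0 + 1 = pos (up h) - z :> int by rewrite /= hz; ring.
have -> : 0 - 1 = pos (down h) - z :> int by rewrite /= hz; ring.
by apply: lerD; apply: ler_wpM2l => //; apply: hit_step => //; apply: step;
  rewrite /= hz -subr_eq0 [_ - z]addrAC subrr.
Qed.

End Returns.

(** Time is cut into j blocks. In each of them, whatever the past, the site where the block starts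
    receives m + 1 more visits with probability at least r^(m+1). *)
Lemma top_le_expect (L m j : nat) (h : seq int) :
  let r := 2 * q - decay ^+ L.+1 in 0 <= r ->
  E (j * (m.+1 * L.+1)) (fun h => (top h <= m)%N%:R) h <= (1 - r ^+ m.+1) ^+ j.
Proof.
move=> r r0.
have p0' : 0 <= p by exact: ltW.
have q0' : 0 <= q by exact: ltW.
have pq1 : p + q = 1 by rewrite /p subrK.
set F := fun h => _.
have rle1 : r <= 1.
  rewrite /r lerBlDr (le_trans (ltW q2)) // lerDl.
  by rewrite exprn_ge0 // ltW // decay_gt0.
have mono n : forall h, (m < top h)%N -> E n F h = 0.
  elim: n => [|n IH] h' mh /=; first by rewrite /F leqNgt mh.
  by rewrite !IH ?mulr0 ?addr0 // (leq_trans mh) // top_cons_ge.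
have one h' : E (m.+1 * L.+1) F h' <= (1 - r ^+ m.+1) * F h'.
  case: (ltnP m (top h')) => mh.
    by rewrite mono // /F leqNgt mh mulr0.
  rewrite {2}/F mh mulr1 lerBrDr -lerBrDl.
  apply: (le_trans (@returns_ge L r0 (pos h') (count_mem (pos h') h' + m.+1)
            m.+1 0 h' erefl (leqnn _))).
  rewrite add0n lerBrDr -expectD -[leRHS](expect_cst pq1 (m.+1 * L.+1) 1 h').
  apply: expect_le => // h2; rewrite /F.
  case: leqP => [|_]; last by rewrite add0r; case: leqP.
  move=> c2; rewrite [(top h2 <= m)%N]leqNgt.
  rewrite (leq_trans (leq_addl _ _) (leq_trans c2 (count_le_top _ _))) /=.
  by rewrite addr0.
elim: j h => [|j IH] h; first by rewrite mul0n expr0 /= /F; case: leqP.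
rewrite mulSn addnC expect_expect.
apply: (le_trans (expect_le p0' q0' _ _ one)).
by rewrite expectZ [leRHS]exprS ler_wpM2l // subr_ge0 exprn_ile1.
Qed.

End Kernels.

(** * Joint visits to two sites *)

(** Histories run backwards, so this [take] drops what precedes the first visit to the pair, and no
    visit is lost. *)
Lemma first_visit (z z' : int) (h : seq int) : (0 < count_mem z h + count_mem z' h)%N ->
  exists2 i, (i < size h)%N & let l := take i.+1 h in
  [/\ last 0 l \in [:: z; z'], count_mem z l = count_mem z h
    & count_mem z' l = count_mem z' h].
Proof.
elim: h => //= y h IH.
have [h0|] := posnP (count_mem z h + count_mem z' h).
  move: h0 => /eqP; rewrite addn_eq0 => /andP[/eqP c0 /eqP c0'].
  rewrite c0 c0' !addn0 => yz; exists 0%N => //; rewrite take0 /= !addn0 !inE.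
  by split=> //; case: eqP yz => //= _; case: eqP.
move=> /IH[i ih [l1 l2 l3]] _; exists i.+1 => //=; split.
- by case: (h) ih l1 => [|x h'] //.
- by rewrite l2.
- by rewrite l3.
Qed.

Section TwoSites.
Variables (R : realFieldType) (p q : R).
Hypotheses (p0 : 0 <= p) (q0 : 0 <= q) (pq1 : p + q = 1).
Local Notation E := (expect p q).
Variables (t s C : R) (G : int -> R) (d : int).
Hypotheses (t1 : 1 <= t) (s1 : 1 <= s) (G1 : forall x, 1 <= G x)
  (GC : forall x, G x <= C) (d0 : d != 0).
Let w (x : int) : R := (if x == 0 then t else 1) * (if x == d then s else 1).
Hypothesis wG : forall x,
  p * (w (x + 1) * G (x + 1)) + q * (w (x - 1) * G (x - 1)) <= G x.

(** Exponential weight of the visits to z and z + d; the bounded correction [G] at the relative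
    position turns it into a supermartingale. *)
Definition pair_weight (z : int) (l : seq int) : R :=
  t ^+ count_mem z l * s ^+ count_mem (z + d) l * G (pos l - z).

Definition birth_weight (l : seq int) : R :=
  pair_weight (last 0 l) l + pair_weight (last 0 l - d) l.

(* Every time [i] counts as a birth of the two pairs that contain the current
   site, whether or not they were visited before: only the terms born at a
   first visit matter, and each birth costs a bounded amount. *)
Definition total_weight (h : seq int) : R :=
  \sum_(0 <= i < size h) birth_weight (take i.+1 h).

Lemma pair_weight_cons z y l : pair_weight z (y :: l) =
  t ^+ count_mem z l * s ^+ count_mem (z + d) l * (w (y - z) * G (y - z)).
Proof.
rewrite /pair_weight /w /= !exprD subr_eq0 [y - z == d]subr_eq [d + z]addrC.
by case: (y == z); case: (y == z + d); rewrite ?expr1 ?expr0; ring.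
Qed.

Lemma pair_weight_super z l :
  p * pair_weight z (up l) + q * pair_weight z (down l) <= pair_weight z l.
Proof.
rewrite !pair_weight_cons /pair_weight.
set A := t ^+ _ * _.
have A0 : 0 <= A by rewrite mulr_ge0 ?exprn_ge0 ?(le_trans ler01).
apply: le_trans (ler_wpM2l A0 (wG _)).
rewrite ![_ + 1 - z]addrAC ![_ - 1 - z]addrAC le_eqVlt.
by apply/orP; left; apply/eqP; ring.
Qed.

Lemma pair_weight_ge (z : int) (l : seq int) (i j : nat) : (i <= count_mem z l)%N ->
  (j <= count_mem (z + d)%R l)%N -> t ^+ i * s ^+ j <= pair_weight z l.
Proof.
move=> hi hj; rewrite /pair_weight -[leLHS]mulr1.
have t0 : 0 <= t by rewrite (le_trans ler01).
have s0 : 0 <= s by rewrite (le_trans ler01).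
apply: ler_pM => //; first by rewrite mulr_ge0 ?exprn_ge0.
by apply: ler_pM; rewrite ?exprn_ge0 // ler_weXn2l.
Qed.

Lemma birth_weight_ge0 l : 0 <= birth_weight l.
Proof.
have h z : 0 <= pair_weight z l.
  by apply: le_trans (pair_weight_ge (leq0n _) (leq0n _)); rewrite mulr1.
by rewrite addr_ge0.
Qed.

Lemma birth_weight_new y : birth_weight [:: y] <= (t + s) * C.
Proof.
have t0 : 0 <= t by rewrite (le_trans ler01).
have s0 : 0 <= s by rewrite (le_trans ler01).
rewrite /birth_weight /pair_weight /= !addn0 !eqxx -subr_eq0 opprD addNKr.
rewrite oppr_eq0 (negbTE d0) -subr_eq0 opprB addrCA subrr addr0 (negbTE d0).
rewrite subrK eqxx !expr1 !expr0 mulr1 mul1r mulrDl.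
by apply: lerD; apply: ler_wpM2l.
Qed.

Lemma total_weight_cons x h : total_weight (x :: h) =
  birth_weight [:: x] + \sum_(0 <= i < size h) birth_weight (x :: take i.+1 h).
Proof. by rewrite /total_weight /= big_nat_recl //= take0. Qed.

Lemma birth_weight_super l : l != [::] ->
  p * birth_weight (up l) + q * birth_weight (down l) <= birth_weight l.
Proof.
case: l => // y l _; rewrite /birth_weight /=.
apply: le_trans (lerD (pair_weight_super _ _) (pair_weight_super _ _)).
by rewrite le_eqVlt; apply/orP; left; apply/eqP; rewrite /up /down /=; ring.
Qed.

(** The terms already born form a supermartingale, and a step adds a single new birth, of weight at
    most (t + s) C. *)
Lemma total_weight_step h :
  p * total_weight (up h) + q * total_weight (down h) <=
  total_weight h + (t + s) * C.
Proof.
rewrite !total_weight_cons; set a := birth_weight [:: _].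
set a' := birth_weight [:: _].
set S := (X in a + X); set S' := (X in a' + X).
rewrite (mulrDr p a) (mulrDr q a') addrACA addrC.
apply: lerD; last first.
  by rewrite -[leRHS]mul1r -pq1 mulrDl; apply: lerD; apply: ler_wpM2l => //;
    exact: birth_weight_new.
rewrite /S /S' !mulr_sumr -big_split /total_weight !big_nat /=.
apply: ler_sum => i ih.
have l0 : take i.+1 h != [::] by case: (h) ih.
have := birth_weight_super l0; rewrite /up /down.
by have -> : pos (take i.+1 h) = pos h by case: (h) ih.
Qed.

Lemma expect_total_weight n h :
  E n total_weight h <= total_weight h + n%:R * ((t + s) * C).
Proof.
elim: n h => [|n IH] h; first by rewrite mul0r addr0.
rewrite /= -[n.+1]addn1 natrD mulrDl mul1r.
apply: le_trans (lerD (ler_wpM2l p0 (IH _)) (ler_wpM2l q0 (IH _))) _.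
rewrite !mulrDr addrACA -mulrDl pq1 mul1r [n%:R * _ + _]addrC addrA lerD2r.
exact: total_weight_step.
Qed.

(** The term born at the first visit to the pair records all of its visits; the other terms are
    nonnegative. *)
Lemma total_weight_ge (h : seq int) (z : int) (i j : nat) : (0 < i + j)%N ->
  (i <= count_mem z h)%N -> (j <= count_mem (z + d)%R h)%N ->
  t ^+ i * s ^+ j <= total_weight h.
Proof.
move=> ij hi hj.
have [|k kh [kl k1 k2]] := @first_visit z (z + d) h.
  by rewrite (leq_trans ij) // leq_add.
rewrite /total_weight (bigD1_seq k) ?iota_uniq ?mem_index_iota //=.
rewrite ler_wpDr ?sumr_ge0 // => [l _|]; first exact: birth_weight_ge0.
have pw0 z' l : 0 <= pair_weight z' l.
  by apply: le_trans (pair_weight_ge (leq0n _) (leq0n _)); rewrite mulr1.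
have : t ^+ i * s ^+ j <= pair_weight z (take k.+1 h).
  by apply: pair_weight_ge; rewrite (k1, k2).
move/le_trans; apply; rewrite /birth_weight.
by move: kl; rewrite !inE => /orP[]/eqP ->; rewrite ?addrK;
  [exact: ler_wpDr|exact: ler_wpDl].
Qed.

(** Markov's inequality for [total_weight], whose expectation grows at most linearly in n. *)
Lemma visits_expect n (A : pred (seq int)) (i j : nat) : (0 < i + j)%N ->
  (forall h, A h -> exists z,
     (i <= count_mem z h)%N /\ (j <= count_mem (z + d)%R h)%N) ->
  E n (fun h => (A h)%:R) [::] <= n%:R * ((t + s) * C) / (t ^+ i * s ^+ j).
Proof.
move=> ij hA.
have t0 : 0 < t by rewrite (lt_le_trans ltr01).
have s0 : 0 < s by rewrite (lt_le_trans ltr01).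
rewrite ler_pdivlMr ?mulr_gt0 ?exprn_gt0 // mulrC -expectZ.
have := expect_total_weight n [::].
rewrite {2}/total_weight big_nil add0r; apply: le_trans.
apply: expect_le => // h; case: (boolP (A h)) => [/hA[z [hi hj]]|_].
  by rewrite mulr1; exact: total_weight_ge hi hj.
rewrite mulr0; apply: sumr_ge0 => ? _; exact: birth_weight_ge0.
Qed.

End TwoSites.

(** * Exponential bounds for one site and for close pairs *)

Section VisitBounds.
Variables (R : rcfType) (q : R).
Hypotheses (q0 : 0 < q) (q2 : 2 * q < 1).
Let p := 1 - q.
Let b := q / p.
Let k := 3 / (2 * q - b).
Local Notation E := (expect p q).
Local Notation hitp := (hit_prob q).
Local Notation avg := (step_avg q).

Let p0 : 0 < p.
Proof. by have h := q2; have h' := q0; rewrite /p; lra. Qed.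
Let pq1 : p + q = 1. Proof. by rewrite /p subrK. Qed.
Let b0 : 0 < b. Proof. exact: divr_gt0. Qed.
Let b1 : b < 1.
Proof. by have h := q2; rewrite /b ltr_pdivrMr // mul1r /p; lra. Qed.
Let bq : b < 2 * q.
Proof.
by have h := q2; have h' := q0; rewrite /b ltr_pdivrMr // /p; nra.
Qed.
Let k0 : 0 < k. Proof. by rewrite divr_gt0 ?subr_gt0. Qed.

(* As [k] tends to infinity, [t * s] tends to
   2 (1 + b) / ((1 + 2q) (2q + b)), which exceeds 1 / (2q) because [b < 2q];
   the above [k] is large enough. *)
Let t := (1 + 2 * k) / (1 + k * (1 + 2 * q)).
Let s := (1 + k * (1 + b)) / (1 + k * (2 * q + b)).

Let dent : 0 < 1 + k * (1 + 2 * q).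
Proof. by rewrite ltr_wpDr // mulr_ge0 ?ltW // addr_gt0 // mulr_gt0. Qed.
Let dens : 0 < 1 + k * (2 * q + b).
Proof. by rewrite ltr_wpDr // mulr_ge0 ?ltW // addr_gt0 // mulr_gt0. Qed.

Let t1 : 1 < t.
Proof.
rewrite ltr_pdivlMr // mul1r ltrD2l [2 * k]mulrC ltr_pM2l //.
by have := q2; lra.
Qed.

Let s1 : 1 < s.
Proof. by rewrite ltr_pdivlMr // mul1r ltrD2l ltr_pM2l // ltrD2r. Qed.

Let ts_gt : (2 * q)^-1 < t * s.
Proof.
have q20 : 0 < 2 * q by rewrite mulr_gt0.
rewrite /t /s mulf_div -[ltLHS]mul1r ltr_pdivlMr ?mulr_gt0 // mulrAC mul1r.
rewrite ltr_pdivrMr // -subr_gt0.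
set X := (X in 0 < X).
have -> : X = (1 - 2 * q) * (k ^+ 2 * (2 * q - b) - k * (1 + b) - 1).
  by rewrite /X; ring.
rewrite mulr_gt0 ?subr_gt0 //.
have e0 : 2 * q - b != 0 by rewrite subr_eq0 gt_eqF.
(* By the choice of [k]; then 3k beats k (1 + b) + 1, as b < 1 and k > 3. *)
have -> : k ^+ 2 * (2 * q - b) = 3 * k.
  by rewrite expr2 -mulrA {2}/k divfK // mulrC.
have : 3 < k.
  by rewrite /k ltr_pdivlMr ?subr_gt0 //; have := b0; have := q2; lra.
by have := b1; have := k0; nra.
Qed.

Section Potential.
Variable d : nat.
Hypothesis d0 : (0 < d)%N.

Let g (x : int) : R := 1 + k * (hitp x + hitp (x - d%:Z)).
Let G := avg g.
Let w (x : int) : R :=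
  (if x == 0 then t else 1) * (if x == d%:Z then s else 1).

Let avg_le (f f' : int -> R) x : (forall x, f x <= f' x) -> avg f x <= avg f' x.
Proof.
move=> ff'; rewrite /avg -/p.
by apply: lerD; apply: ler_wpM2l; rewrite // ltW.
Qed.

Let avg_cst c x : avg (fun=> c) x = c.
Proof. by rewrite /avg -mulrDl -/p pq1 mul1r. Qed.

Let avgG x : G x = 1 + k * (avg hitp x + avg hitp (x - d%:Z)).
Proof.
rewrite /G /step_avg /g ![_ + 1 - _]addrAC ![_ - 1 - _]addrAC; ring.
Qed.

(** Off 0 and d, [g] is harmonic. At 0 equality holds and determines [t], because d is hit for sure
    from 0. At d the worst case is [hitp d = b], attained for d = 1, which determines [s]. *)
Let wG_le x : w x * G x <= g x.
Proof.
have dz : d%:Z != 0 by rewrite eqz_nat -lt0n.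
rewrite avgG /w /g; have [->|x0] := eqVneq x 0.
  rewrite eq_sym (negbTE dz) mulr1 avg_hit_prob0 // avg_hit_prob ?subr_eq0 1?eq_sym //.
  rewrite hit_prob0 sub0r; have -> : hitp (- d%:Z) = 1.
    by rewrite /hit_prob; case: d d0.
  rewrite /t [2 * q + 1]addrC divfK ?gt_eqF // le_eqVlt; apply/orP; left.
  by apply/eqP; ring.
have [->|xd] := eqVneq x d%:Z; last first.
  by rewrite !mul1r !avg_hit_prob // subr_eq0.
rewrite mul1r subrr avg_hit_prob // avg_hit_prob0 // hit_prob0.
have hb : hitp d%:Z <= b.
  rewrite /hit_prob /= -/b; case: d d0 => // n _.
  rewrite exprSz ler_piMr ?(ltW b0) //.
  exact: exprn_ile1 (ltW b0) (ltW b1).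
rewrite /s mulrAC ler_pdivrMr //.
have h1 := hb; have h2 := k0; have h3 := q2.
rewrite -subr_ge0; set X := (X in 0 <= X).
have -> : X = k ^+ 2 * (1 - 2 * q) * (b - hitp d%:Z).
  by rewrite /X; ring.
by rewrite mulr_ge0 ?subr_ge0 // mulr_ge0 ?subr_ge0 ?exprn_ge0 ?ltW.
Qed.

Lemma pair_visits_expect n (A : pred (seq int)) (i j : nat) : (0 < i + j)%N ->
  (forall h, A h -> exists z : int,
     (i <= count_mem z h)%N /\ (j <= count_mem (z + d%:Z)%R h)%N) ->
  E n (fun h => (A h)%:R) [::]
    <= n%:R * ((t + s) * (1 + 2 * k)) / (t ^+ i * s ^+ j).
Proof.
have hit0 x : 0 <= hitp x by case/andP: (hit_prob_itv q0 q2 x).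
have hit1 x : hitp x <= 1 by case/andP: (hit_prob_itv q0 q2 x).
move=> ij hA; apply: (@visits_expect _ p q _ _ _ _ _ _ G d%:Z) => //.
- exact: ltW.
- exact: ltW.
- exact: ltW.
- exact: ltW.
- move=> x; rewrite -[leLHS](avg_cst 1 x); apply: avg_le => y.
  by rewrite /g lerDl mulr_ge0 ?(ltW k0) // addr_ge0 ?hit0.
- move=> x; rewrite -[leRHS](avg_cst (1 + 2 * k) x); apply: avg_le => y.
  by rewrite /g lerD2l [2 * k]mulrC ler_pM2l // -[2]/(1 + 1) lerD ?hit1.
- by rewrite eqz_nat -lt0n.
- by move=> x; exact: (@avg_le (fun y => w y * G y) g x wG_le).
Qed.

End Potential.

(** Level m is reached after roughly (2q)^-m steps, so a rate [rho] above 1/(2q) rules out close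
    pairs by then. *)
Lemma visit_bounds : exists (tau rho C : R), [/\ 1 < tau, (2 * q)^-1 < rho, 0 < C,
  forall n m, (0 < m)%N ->
    E n (fun h => (m <= top h)%N%:R) [::] <= n%:R * C / tau ^+ m &
  forall D n m, (0 < m)%N ->
    E n (fun h => (close D m h)%:R) [::] <= n%:R * C * D%:R / rho ^+ m].
Proof.
have t0 : 0 < t by rewrite (lt_trans ltr01).
have s0 : 0 < s by rewrite (lt_trans ltr01).
exists t, (t * s), ((t + s) * (1 + 2 * k)); split => //.
- by rewrite mulr_gt0 ?addr_gt0 // mulr_gt0.
- move=> n m m0.
  (* A single site is a pair whose second member needs no visit. *)
  rewrite -[t ^+ m]mulr1 -(expr0 s).
  apply: (@pair_visits_expect 1) => //; first by rewrite addn0.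
  move=> h mh; have [z zh zt] := top_attained (leq_trans m0 mh).
  by exists z; rewrite zt.
- move=> D n m m0.
  (* Union bound over the distance d between the two sites. *)
  have ex h : (close D m h)%:R <= \sum_(1 <= d < D)
      (has (fun z => (m <= count_mem z h)%N &&
                     (m <= count_mem (z + d%:Z)%R h)%N) h)%:R :> R.
    case: (boolP (close _ _ _)) => [|_]; last by apply: sumr_ge0.
    case/hasP => z zh /hasP[z' z'h /and4P[zz dz c c']].
    wlog zlt : z z' zh z'h zz dz c c' / z < z'.
      move=> H; case: (ltgtP z z') => [lt|lt|e]; first exact: (H z z').
        by apply: (H z' z) => //; rewrite 1?eq_sym // distnC.
      by rewrite e eqxx in zz.
    pose d := absz (z' - z).
    have dE : z + d%:Z = z'.
      by rewrite /d gez0_abs ?subr_ge0 ?(ltW zlt) // [z + _]addrC subrK.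
    rewrite (bigD1_seq d) ?iota_uniq //=; last first.
      by rewrite mem_index_iota /d distnC dz andbT lt0n absz_eq0 subr_eq0.
    rewrite ler_wpDr ?sumr_ge0 // -[leLHS]/(true%:R) ler_nat.
    by rewrite (_ : has _ _) //; apply/hasP; exists z; rewrite // c dE.
  apply: le_trans (expect_le (ltW p0) (ltW q0) n [::] ex) _.
  rewrite expect_sum.
  apply: (@le_trans _ _ (\sum_(1 <= d < D)
      (n%:R * ((t + s) * (1 + 2 * k)) / (t * s) ^+ m))).
    rewrite !big_nat; apply: ler_sum => d /andP[d0 _].
    rewrite exprMn; apply: (@pair_visits_expect d d0) => //.
      by rewrite addn_gt0 m0.
    by move=> h /hasP[z _ /andP[? ?]]; exists z.
  have C0 : 0 <= n%:R * ((t + s) * (1 + 2 * k)).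
    have := k0; have := t0; have := s0; move=> h1 h2 h3.
    rewrite mulr_ge0 ?ler0n // mulr_ge0 //; lra.
  rewrite sumr_const_nat -[leLHS]mulr_natr [leLHS]mulrAC ler_pM2r; last first.
    by rewrite invr_gt0 exprn_gt0 // mulr_gt0.
  by rewrite ler_wpM2l // ler_nat leq_subr.
Qed.

End VisitBounds.

(** * Upper bound on the number of favorites at one level *)

Lemma int_step_pos (x : int) : x != 0 -> 0 <= x -> (0 <= x + 1) && (0 <= x - 1).
Proof. lia. Qed.

Lemma int_step_neg (x : int) : x < 0 -> x - 1 < 0 /\ (0 <= x + 1 -> x + 1 = 0).
Proof. lia. Qed.

Section UpperPotential.
Variables (R : rcfType) (q : R).
Hypotheses (q0 : 0 < q) (q2 : 2 * q < 1).
Let p := 1 - q.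
Let b := q / p.
Local Notation E := (expect p q).
Local Notation avg := (step_avg q).

Variables (D m k : nat) (a : R).
Hypotheses (D0 : (0 < D)%N) (m0 : (0 < m)%N)
  (a_ge : (1 - 2 * q) * ((1 + b ^+ D) / (1 - b ^+ D)) <= a).

Let p0 : 0 < p.
Proof. by have h := q2; have h' := q0; rewrite /p; lra. Qed.
Let pq1 : p + q = 1. Proof. by rewrite /p subrK. Qed.
Let b0 : 0 < b. Proof. exact: divr_gt0. Qed.
Let b1 : b < 1.
Proof. by have h := q2; rewrite /b ltr_pdivrMr // mul1r /p; lra. Qed.
Let b01 : 0 < b < 1. Proof. by rewrite b0 b1. Qed.
Let B := b ^+ D.
Let B0 : 0 < B. Proof. exact: exprn_gt0. Qed.
Let B1 : 0 < 1 - B. Proof. by rewrite subr_gt0 exprn_ilt1 ?ltW // -lt0n. Qed.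
Let a0 : 0 <= a.
Proof.
apply: le_trans a_ge; rewrite mulr_ge0 ?subr_ge0 ?(ltW q2) //.
by rewrite divr_ge0 ?(ltW B1) // addr_ge0 // ltW.
Qed.

(* Harmonic off 0, vanishes at 0 and is at least [1 - B] outside of (-D, D). *)
Let f (x : int) : R := if 0 <= x then 1 - b ^ x else B * (b ^ x - 1).

Let f_ge0 x : 0 <= f x.
Proof.
rewrite /f; case: ifP => x0.
  by rewrite subr_ge0; case/andP: (exprz_itv b01 x0).
by rewrite mulr_ge0 ?(ltW B0) // subr_ge0 exprz_ge1 // ltW // ltNge x0.
Qed.

Let f_far x : (D <= absz x)%N -> 1 - B <= f x.
Proof.
move=> Dx; rewrite /f; case: ifP => x0.
  rewrite lerD2l lerN2; case: x x0 Dx => // n _ Dn.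
  by rewrite -[b ^ _]/(b ^+ n) ler_wiXn2l // ltW.
rewrite mulrBr mulr1 lerD2r; case: x x0 Dx => // n _ Dn.
rewrite NegzE -invr_expz -[b ^ _]/(b ^+ n.+1).
by rewrite ler_pdivlMr ?exprn_gt0 // mul1r ler_wiXn2l ?ltW.
Qed.

Let avg_aff (c c' : R) x :
  avg (fun x => c + c' * b ^ x) x = c + c' * b ^ x.
Proof.
transitivity (c * (p + q) + c' * avg (fun x => b ^ x) x).
  by rewrite /step_avg -/p; ring.
by rewrite pq1 mulr1 avg_exprz.
Qed.

Let avg_f x : x != 0 -> avg f x = f x.
Proof.
move=> x0; have [xp|xn] := leP 0 x.
  transitivity (avg (fun x => 1 + - 1 * b ^ x) x); last first.
    by rewrite avg_aff /f xp mulN1r.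
  by have /andP[h1 h2] := int_step_pos x0 xp; rewrite /step_avg /f h1 h2 !mulN1r.
transitivity (avg (fun x => - B + B * b ^ x) x); last first.
  by rewrite avg_aff /f leNgt xn /= mulrBr mulr1 addrC.
have [h1 h2] := int_step_neg xn.
rewrite /step_avg /f [0 <= x - 1]leNgt h1.
case: ifP => h; last by rewrite /=; ring.
have -> : x + 1 = 0 by exact: h2.
by rewrite /= expr0z; ring.
Qed.

(** Divided by 1 - B, this bounds the probability to get D away from 0 before returning to it, hence
    the hypothesis on [a]. *)
Let avg_f0 : avg f 0 = (1 - 2 * q) * (1 + B).
Proof.
rewrite /step_avg /f /= expr1z -[b ^ _]/(b^-1) -/p.
have e1 : p * b = q by rewrite /b mulrCA divff ?mulr1 // gt_eqF.
have e2 : q * b^-1 = p by rewrite /b invf_div mulrCA divff ?mulr1 // gt_eqF.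
transitivity (p - p * b + B * (q * b^-1 - q)); first by ring.
by rewrite e1 e2 /p; ring.
Qed.

Let v (x : int) : R := Num.min 1 (f x / (1 - B)).
(** The value [a] at 0 is for a walk that has just made the site a favorite. A later return is worth
    0, but it raises the level and is handled by [V]. *)
Let vv (x : int) : R := if x == 0 then a else v x.

Let v_ge0 x : 0 <= v x.
Proof. by rewrite /v le_min ler01 divr_ge0 // ltW. Qed.

Let v_far x : (D <= absz x)%N -> v x = 1.
Proof.
by move=> /f_far h; rewrite /v; apply/min_idPl; rewrite ler_pdivlMr ?mul1r.
Qed.

Let avg_v x : avg v x <= vv x.
Proof.
have h : avg v x <= avg f x / (1 - B).
  rewrite /step_avg -/p [leRHS]mulrDl -[p * f _ / _]mulrA -[q * f _ / _]mulrA.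
  by apply: lerD; apply: ler_wpM2l; rewrite ?(ltW p0) ?(ltW q0) //
    /v ge_min lexx orbT.
rewrite /vv; case: eqP => [x0|/eqP x0].
  by apply: le_trans h _; rewrite x0 avg_f0 -mulrA.
rewrite [leRHS]/v le_min -(avg_f x0) h andbT /step_avg -[leRHS]pq1.
by apply: lerD; rewrite -/p ler_piMr ?(ltW p0) ?(ltW q0) // /v ge_min lexx.
Qed.

Definition spread_favorites (h : seq int) : bool :=
  [&& (top h <= m)%N, (k < nreach m h)%N & ~~ close D m h].

(* Each of the [k + 1 - nreach m h] missing favorites costs a factor [a]: the
   walk has to get far from the last one before returning to it. *)
Let V (h : seq int) : R :=
  if (m < top h)%N || close D m h then 0
  else if (k < nreach m h)%N then 1
  else if nreach m h == 0%N then a ^+ k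
  else a ^+ (k - nreach m h) * vv (pos h - last_reach m h).

Let V_super h : ~~ spread_favorites h ->
  p * V (up h) + q * V (down h) <= V h.
Proof.
rewrite /spread_favorites leqNgt => nA.
have [dead|alive] := boolP ((m < top h)%N || close D m h).
  have z y : V (y :: h) = 0.
    rewrite /V ifT //; case/orP: dead => [hm|/close_cons -> ]; last by rewrite orbT.
    by rewrite (leq_trans hm) // top_cons_ge.
  by rewrite !z !mulr0 addr0 /V dead.
move: (alive); rewrite negb_or => /andP[hm nc].
have Jk : (nreach m h <= k)%N by move: nA; rewrite hm nc andbT -leqNgt.
have [J0|J0] := posnP (nreach m h).
  have z y : V (y :: h) <= a ^+ k.
    rewrite /V; case: ifP => _; first by rewrite exprn_ge0.
    rewrite [nreach _ _]/= [last_reach _ _]/= J0 add0n.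
    case: ((count_mem y h).+1 == m) => /=; last by [].
    case: ifP => [k0|]; first by move: k0; rewrite ltnS leqn0 => /eqP ->; rewrite expr0.
    by move/negbT; rewrite -leqNgt subrr /vv eqxx => k0; rewrite -exprSr subn1 prednK.
  rewrite {3}/V (negbTE alive) J0 /=.
  rewrite -[leRHS]mul1r -pq1 [leRHS]mulrDl.
  by apply: lerD; apply: ler_wpM2l; first [exact: ltW|exact: z].
have z y : V (y :: h) <= a ^+ (k - nreach m h) * v (y - last_reach m h).
  rewrite /V; case: ifP => [_|/negbT]; first by rewrite mulr_ge0 ?exprn_ge0.
  rewrite negb_or => /andP[hm' nc'].
  have cL := last_reach_count J0.
  (* A return to the last favorite would push the maximum above m. *)
  have yL : y != last_reach m h.
    apply: contra hm' => /eqP ->.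
    rewrite (leq_trans _ (count_le_top (last_reach m h) _)) //=.
    by rewrite eqxx.
  rewrite [nreach _ _]/= [last_reach _ (_ :: _)]/=.
  have [cy|cy] := eqVneq (count_mem y h).+1 m; last first.
    rewrite addn0 ltnNge Jk /= (gtn_eqF J0) /vv.
    by rewrite subr_eq0 (negbTE yL).
  (* A new favorite nearer than D would create a close pair; at distance D the factor [v] is already
     1, so a fresh factor [a] can be paid. *)
  have far : (D <= absz (y - last_reach m h))%N.
    rewrite leqNgt; apply: contra nc' => d.
    apply: (close_intro m0 yL d); rewrite /= ?eqxx ?add1n ?cy //.
    by rewrite (leq_trans cL) // leq_addl.
  rewrite v_far // mulr1 addn1 /=; case: ifP => [kJ|/negbT].
    have -> : nreach m h = k by apply/eqP; rewrite eqn_leq Jk.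
    by rewrite subnn expr0.
  by rewrite -leqNgt subrr /vv eqxx => kJ; rewrite -exprSr subnSK.
rewrite {3}/V (negbTE alive) ltnNge Jk /= (gtn_eqF J0).
apply: (@le_trans _ _ (a ^+ (k - nreach m h) * avg v (pos h - last_reach m h))).
  rewrite /step_avg mulrDr -/p ![_ ^+ _ * (_ * _)]mulrCA addrAC [_ - _ - 1]addrAC.
  by apply: lerD; apply: ler_wpM2l; first [exact: ltW|exact: z].
by rewrite ler_wpM2l ?exprn_ge0.
Qed.

Lemma expect_spread_favorites n :
  E n (fun h => (ever spread_favorites h)%:R) [::] <= a ^+ k.
Proof.
have -> : a ^+ k = V [::] by [].
apply: expect_ever_le; rewrite ?(ltW p0) ?(ltW q0) //= ?orbF //.
- move=> h; rewrite /V; do 2 case: ifP => // _; case: ifP => _; rewrite ?exprn_ge0 //.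
  by rewrite mulr_ge0 ?exprn_ge0 // /vv; case: ifP.
- by move=> h /and3P[hm kJ nc]; rewrite /V ltnNge hm (negbTE nc) kJ.
Qed.

End UpperPotential.

(** * Lower bound over a range of levels *)

Section LowerPotential.
Variables (R : rcfType) (q : R).
Hypotheses (q0 : 0 < q) (q2 : 2 * q < 1).
Let p := 1 - q.
Let g := 1 - 2 * q.
Local Notation E := (expect p q).
Local Notation avg := (step_avg q).
Local Notation hitp := (hit_prob q).

Variables (k : nat -> nat) (l u : nat).
Hypotheses (l0 : (0 < l)%N) (lu : (l <= u)%N)
  (gk : forall i, (l <= i)%N -> i%:R^-1 <= g ^+ k i).

Let p0 : 0 < p.
Proof. by have h := q2; have h' := q0; rewrite /p; lra. Qed.
Let pq1 : p + q = 1. Proof. by rewrite /p subrK. Qed.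
Let g0 : 0 <= g. Proof. by rewrite subr_ge0 ltW. Qed.
Let g1 : g <= 1. Proof. by rewrite gerBl mulr_ge0 // ltW. Qed.
Let u0 : 0 < u%:R :> R. Proof. by rewrite ltr0n (leq_trans l0). Qed.

Let e (x : int) : R := 1 - hitp x.
(** Probability that the walk from x does not visit 0 later, the present time being excluded; [e]
    includes it. *)
Let ee (x : int) : R := if x == 0 then g else e x.

Let e_itv x : 0 <= e x <= 1.
Proof.
have /andP[h0 h1] := hit_prob_itv q0 q2 x.
by rewrite /e subr_ge0 h1 gerBl h0.
Qed.

Let e_neg x : x <= 0 -> e x = 0.
Proof.
rewrite /e /hit_prob; case: ifP => [x0 x0'|_ _]; last exact: subrr.
have -> : x = 0 by lia.
by rewrite expr0z subrr.
Qed.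

Let ee_itv x : 0 <= ee x <= 1.
Proof. by rewrite /ee; case: ifP => // _; rewrite g0 g1. Qed.

Let e_le x : e x <= ee x.
Proof. by rewrite /ee; case: eqP => // ->; rewrite e_neg. Qed.

Let avg_e x : avg e x = ee x.
Proof.
transitivity (1 - avg hitp x).
  by rewrite -[X in X - _]pq1 /step_avg -/p /e; ring.
rewrite /ee; case: eqP => [->|/eqP x0]; first by rewrite avg_hit_prob0.
by rewrite avg_hit_prob.
Qed.

Definition many_favorites (h : seq int) : bool :=
  (l <= top h)%N && (k (top h) < nreach (top h) h)%N.

(* Bounds from below the probability that level [M] still produces [k M + 1]
   favorites; the position is relative to the rightmost favorite so far. *)
Let V (M : nat) (h : seq int) : R :=
  if (k M < nreach M h)%N then 1
  else g ^+ (k M - nreach M h) * ee (pos h - right_reach M h).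

Let V_itv M h : 0 <= V M h <= 1.
Proof.
rewrite /V; case: ifP => _; first by rewrite ler01 lexx.
have /andP[e0 e1] := ee_itv (pos h - right_reach M h).
by rewrite mulr_ge0 ?exprn_ge0 //= mulr_ile1 ?exprn_ge0 ?exprn_ile1.
Qed.

(* The levels fail with probability at most [1 - i^-1] each, which telescopes. *)
Let U (h : seq int) : R :=
  let M := top h in
  if (u < M)%N then 1
  else (maxn M l)%:R / u%:R * (if (l <= M)%N then 1 - V M h else 1).

Let U_ge0 h : 0 <= U h.
Proof.
rewrite /U; case: ifP => // _; rewrite mulr_ge0 ?divr_ge0 //.
case: ifP => // _; rewrite subr_ge0.
by case/andP: (V_itv (top h) h).
Qed.

Let U_le h : (top h <= u)%N -> U h <= (maxn (top h) l)%:R / u%:R.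
Proof.
move=> hu; rewrite /U ltnNge hu /= ler_piMr ?divr_ge0 //.
case: ifP => // _; rewrite gerBl.
by case/andP: (V_itv (top h) h).
Qed.

(* A new level is entered with the value of [U] just after a failure. *)
Let U_new y h : (count_mem y h).+1 = (top h).+1 -> (l <= top h <= u)%N ->
  U (y :: h) <= (top h)%:R / u%:R.
Proof.
move=> cy /andP[lM Mu].
have tE : top (y :: h) = (top h).+1 by rewrite /= cy (maxn_idPr _).
rewrite /U tE; case: ifP => [uM|/negbT].
  have -> : top h = u by lia.
  by rewrite divff // gt_eqF.
rewrite -leqNgt => Mu'; rewrite (leqW lM) (maxn_idPl (leqW lM)).
have VE : V (top h).+1 (y :: h) = g ^+ k (top h).+1.
  rewrite /V /= cy eqxx nreach_eq0 // add0n eqxx subrr /ee eqxx.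
  case: ifP => [|/negbT]; first by rewrite ltnS leqn0 => /eqP ->; rewrite expr0.
  by rewrite -leqNgt => k0; rewrite -exprSr subn1 prednK.
rewrite VE mulrAC ler_pM2r ?invr_gt0 //.
have M0 : 0 < (top h).+1%:R :> R by rewrite ltr0n.
(* With M = [top h], level M + 1 fails with probability at most M / (M + 1), which turns the
   prefactor (M + 1) / u into M / u. *)
have : 1 <= (top h).+1%:R * g ^+ k (top h).+1.
  by rewrite -ler_pdivrMl // mulr1 gk // leqW.
by move=> H; rewrite mulrBr mulr1 lerBlDr -[leLHS]natr1 lerD2l.
Qed.

Let U_super h : ~~ many_favorites h -> p * U (up h) + q * U (down h) <= U h.
Proof.
rewrite /many_favorites => nA.
have avg1 (c : R) : (forall y, U (y :: h) <= c) ->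
    p * U (up h) + q * U (down h) <= c.
  move=> H; rewrite -[leRHS]mul1r -pq1 [leRHS]mulrDl.
  by apply: lerD; apply: ler_wpM2l; first [exact: ltW|exact: H].
have [hl|hl] := ltnP (top h) l.
  have -> : U h = l%:R / u%:R.
    rewrite /U ltnNge (leq_trans (ltnW hl) lu) /=.
    by rewrite (maxn_idPr (ltnW hl)) leqNgt hl mulr1.
  apply: avg1 => y.
  have tl : (top (y :: h) <= l)%N by rewrite (leq_trans (top_cons_le _ _)).
  by apply: le_trans (U_le (leq_trans tl lu)) _; rewrite (maxn_idPr tl).
have [hu|hu] := ltnP u (top h).
  have U1 h' : (u < top h')%N -> U h' = 1 by rewrite /U => ->.
  by rewrite (U1 h hu); apply: avg1 => y; rewrite U1 // (leq_trans hu) // top_cons_ge.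
set M := top h in nA hl hu *.
have M0 : (0 < M)%N by exact: leq_trans hl.
have Jk : (nreach M h <= k M)%N by move: nA; rewrite hl -leqNgt.
have J0 : (0 < nreach M h)%N by rewrite nreach_gt0 // M0 leqnn.
have cM : 0 <= M%:R / u%:R :> R by rewrite divr_ge0.
have z y : U (y :: h) <=
    M%:R / u%:R * (1 - g ^+ (k M - nreach M h) * e (y - right_reach M h)).
  have [cy|cy] := eqVneq (count_mem y h).+1 M.+1.
    (* The next level is opened at a current favorite, which is not to the right of [right_reach],
       so [e] vanishes there. *)
    rewrite e_neg ?mulr0 ?subr0 ?mulr1; first by apply: (U_new cy); rewrite hl.
    have cM1 : (M <= count_mem y h)%N by case: cy => ->.
    by rewrite subr_le0 right_reach_ge // M0.
  have tE : top (y :: h) = M.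
    have := count_le_top y h; rewrite /= -/M => cM'.
    by apply/maxn_idPl; rewrite ltn_neqAle cM' andbT -eqSS.
  rewrite /U tE ltnNge hu /= hl (maxn_idPl hl) ler_wpM2l // lerD2l lerN2.
  rewrite /V /=; have [cy'|cy'] := eqVneq (count_mem y h).+1 M; last first.
    by rewrite addn0 ltnNge Jk /= ler_wpM2l ?exprn_ge0 // e_le.
  rewrite addn1 (gtn_eqF J0) /=; case: ifP => [_|/negbT].
    rewrite mulr_ile1 ?exprn_ge0 ?exprn_ile1 //.
      by case/andP: (e_itv (y - right_reach M h)).
    by case/andP: (e_itv (y - right_reach M h)).
  rewrite -leqNgt => kJ.
  have [yr|yr] := leP y (right_reach M h).
    rewrite e_neg ?subr_le0 // mulr0 mulr_ge0 ?exprn_ge0 //.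
    by case/andP: (ee_itv (y - right_reach M h)).
  (* The new favorite becomes the rightmost one: the exponent drops by one, and [ee 0 = g] makes up
     for it. *)
  rewrite subrr /ee eqxx -exprSr subnSK // ler_piMr ?exprn_ge0 //.
  by case/andP: (e_itv (y - right_reach M h)).
rewrite {3}/U -/M ltnNge hu /= hl (maxn_idPl hl) /V ltnNge Jk /= -avg_e.
apply: le_trans (lerD (ler_wpM2l (ltW p0) (z _)) (ler_wpM2l (ltW q0) (z _))) _.
rewrite /step_avg -/p ![_ + 1 - _]addrAC ![_ - 1 - _]addrAC.
set A := M%:R / _; set G := g ^+ _; set e1 := e _; set e2 := e _.
have -> : p * (A * (1 - G * e1)) + q * (A * (1 - G * e2)) =
   A * ((p + q) - G * (p * e1 + q * e2)) by ring.
by rewrite pq1.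
Qed.

(** Optional stopping for [U], which starts at l / u and equals 1 once level u is passed. *)
Lemma expect_no_many_favorites n :
  E n (fun h => (~~ ever many_favorites h && (u < top h)%N)%:R) [::]
    <= l%:R / u%:R.
Proof.
have -> : l%:R / u%:R = U [::].
  by rewrite /U /= max0n leqNgt l0 mulr1.
suff H h : (ever many_favorites h -> many_favorites h) ->
   E n (fun h => (~~ ever many_favorites h && (u < top h)%N)%:R) h <= U h.
  by apply: H; rewrite /= orbF.
have dead n' h' : ever many_favorites h' ->
    E n' (fun h => (~~ ever many_favorites h && (u < top h)%N)%:R) h' = 0.
  elim: n' h' => [|n' IH] h' eh /=; first by rewrite eh.
  by rewrite !IH ?mulr0 ?addr0 //= eh orbT.
elim: n h => [|n IH] h eA; have [Ah|Ah] := boolP (many_favorites h).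
- by rewrite dead ?ever_here.
- rewrite /=; case: (ltnP u (top h)) => [hu|]; last by rewrite andbF.
  by rewrite /U hu andbT; case: ever.
- by rewrite dead ?ever_here.
- apply: le_trans (U_super Ah) => /=.
  by apply: lerD; apply: ler_wpM2l; rewrite ?(ltW p0) ?(ltW q0) // IH //=
    (negbTE (contra eA Ah)) orbF.
Qed.

End LowerPotential.

(** * From coin tosses to histories *)

Fixpoint trace (c : nat -> bool) (n : nat) : seq int :=
  if n is n'.+1 then (if c n' then up else down) (trace c n') else [::].

Lemma eq_trace c c' n : (forall k, (k < n)%N -> c k = c' k) ->
  trace c n = trace c' n.
Proof.
elim: n => //= n IH cc; rewrite cc // IH // => k kn.
by rewrite cc // ltnS ltnW.
Qed.

Section CoinProbability.
Variables (d : measure_display) (T : measurableType d) (R : realType)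
  (P : probability T R) (p q : R) (X : nat -> {RV P >-> R}).
Hypotheses (pE : p = 1 - q) (X_indep : mutually_independent X)
  (X_id : identically_distributed X)
  (X_up : P (X 0%N @^-1` [set 1]) = p%:E).

(** Every value other than 1 counts as a down step, which is correct almost surely by [steps_ae]. *)
Definition coin (w : T) (k : nat) : bool := X k w == 1.

Let coinE k : [set w | coin w k] = X k @^-1` [set 1].
Proof. by apply/seteqP; split => w /= /eqP. Qed.

Let measurable_coin k : measurable [set w | coin w k].
Proof. by rewrite coinE; exact: measurable_funPTI. Qed.

Lemma measurable_trace (A : pred (seq int)) n :
  measurable [set w | A (trace (coin w) n)].
Proof.
elim: n A => [|n IH] A /=.
  case: (A _).
    by rewrite (_ : mkset _ = setT) //; apply/seteqP.
  by rewrite (_ : mkset _ = set0) //; apply/seteqP; split.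
have -> : [set w | A ((if coin w n then up else down) (trace (coin w) n))] =
    ([set w | coin w n] `&` [set w | A (up (trace (coin w) n))]) `|`
    (~` [set w | coin w n] `&` [set w | A (down (trace (coin w) n))]).
  apply/seteqP; split => w /=; first by case: (coin w n) => ?; [left|right].
  by move=> [[->]|[/negP/negbTE ->]].
apply: measurableU; apply: measurableI => //.
- exact: (IH (fun h => A (up h))).
- exact: measurableC.
- exact: (IH (fun h => A (down h))).
Qed.

Definition cylinder (c : nat -> bool) (n : nat) : set T :=
  [set w | forall k, (k < n)%N -> coin w k = c k].

Let weight (c : nat -> bool) (n : nat) : R :=
  \prod_(0 <= k < n) (if c k then p else q).

Lemma cylinder_prob c n : P (cylinder c n) = (weight c n)%:E.
Proof.
pose A k : set R := if c k then [set 1] else ~` [set 1].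
have mA k : measurable (A k).
  by rewrite /A; case: (c k); [|apply: measurableC]; exact: measurable_set1.
have -> : cylinder c n =
    \bigcap_(i in [set` [fset k in iota 0 n]%fset]) X i @^-1` A i.
  apply/seteqP; split => w /= h k.
    rewrite /= !inE mem_iota add0n => /h; rewrite /coin /A.
    by case: (c k) => /eqP.
  move=> kn; have := h k; rewrite /= !inE mem_iota add0n => /(_ kn).
  by rewrite /coin /A; case: (c k) => /eqP // /negbTE.
rewrite X_indep; last by move=> i _; exact: mA.
have PA k : P (X k @^-1` A k) = (if c k then p else q)%:E.
  have -> : P (X k @^-1` A k) = P (X 0%N @^-1` A k).
    exact: (X_id k 0%N (mA k)).
  rewrite /A; case: (c k) => //.
  rewrite -preimage_setC probability_setC; last exact: measurable_funPTI.
  by rewrite X_up pE -EFinB opprB addrC subrK.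
rewrite (eq_bigr _ (fun k _ => PA k)) prodEFin; congr (_%:E).
rewrite /weight /index_iota subn0.
apply: perm_big; apply: uniq_perm; rewrite ?fset_uniq ?iota_uniq // => k.
by rewrite !inE.
Qed.

Lemma measurable_cylinder c n : measurable (cylinder c n).
Proof.
have -> : cylinder c n = \bigcap_(k in [set k | (k < n)%N]) [set w | coin w k = c k].
  by apply/seteqP; split.
apply: bigcap_measurableType => k _; case: (c k); first exact: measurable_coin.
rewrite (_ : mkset _ = ~` [set w | coin w k]); first exact: measurableC.
by apply/seteqP; split => w /=; [move=> -> |move/negP/negbTE].
Qed.

(** Splitting the cylinder according to toss j reproduces the recursion of [expect]; independence
    enters through the weights of the cylinders. *)
Lemma trace_cylinder_prob (A : pred (seq int)) c j n :
  P (cylinder c j `&` [set w | A (trace (coin w) (j + n))]) =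
  (weight c j * expect p q n (fun h => (A h)%:R) (trace c j))%:E.
Proof.
elim: n j c => [|n IH] j c.
  rewrite addn0 /=; case: (boolP (A _)) => Ac.
    rewrite mulr1 -cylinder_prob; congr (P _).
    apply/seteqP; split => w /=; first by case.
    by move=> h; split => //=; rewrite (eq_trace h).
  rewrite mulr0 (_ : _ `&` _ = set0) ?measure0 //.
  apply/seteqP; split => w //= [h]; rewrite (eq_trace h).
  by rewrite (negbTE Ac).
pose ext v k := if k == j then v else c k.
have cE v : cylinder (ext v) j.+1 = cylinder c j `&` [set w | coin w j = v].
  apply/seteqP; split => w /=.
    move=> h; split; last by rewrite h // /ext eqxx.
    by move=> k kj; rewrite h ?ltnS ?(ltnW kj) // /ext ltn_eqF.
  move=> [h hj] k; rewrite ltnS leq_eqVlt /ext => /orP[/eqP ->|kj].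
    by rewrite eqxx.
  by rewrite ltn_eqF // h.
have tE v : trace (ext v) j = trace c j.
  by apply: eq_trace => k kj; rewrite /ext ltn_eqF.
have wE v : weight (ext v) j.+1 = weight c j * (if v then p else q).
  rewrite /weight big_nat_recr //= {2}/ext eqxx; congr (_ * _).
  by apply: eq_big_nat => k kj; rewrite /ext ltn_eqF.
set S := _ `&` _.
have -> : S =
  (cylinder (ext true) j.+1 `&` [set w | A (trace (coin w) (j.+1 + n))]) `|`
  (cylinder (ext false) j.+1 `&` [set w | A (trace (coin w) (j.+1 + n))]).
  rewrite !cE /S addnS -addSn; apply/seteqP; split => w /=.
    by move=> [h1 h2]; case E: (coin w j); [left|right].
  by move=> [[[h1 _] h2]|[[h1 _] h2]].
rewrite measureU //=.
- rewrite !IH !wE /= !tE /ext !eqxx.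
  by rewrite -EFinD mulrDr !mulrA.
- apply: measurableI; [exact: measurable_cylinder|].
  exact: (measurable_trace A (j.+1 + n)).
- apply: measurableI; [exact: measurable_cylinder|].
  exact: (measurable_trace A (j.+1 + n)).
- rewrite !cE; apply/seteqP; split => w //=.
  by move=> [[[_ h1] _] [[_ h2] _]]; rewrite h1 in h2.
Qed.

Lemma trace_prob (A : pred (seq int)) n :
  P [set w | A (trace (coin w) n)] =
  (expect p q n (fun h => (A h)%:R) [::])%:E.
Proof.
have := trace_cylinder_prob A (fun=> true) 0 n.
rewrite /weight big_geq // mul1r => <-; congr (P _).
by apply/seteqP; split => w //= [].
Qed.

End CoinProbability.

Lemma trace_suffix c n n' : (n <= n')%N ->
  exists h, trace c n' = h ++ trace c n.
Proof.
move/subnK <-; elim: (n' - n)%N => [|j [h IH]]; first by exists [::].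
rewrite addSn /= IH; case: (c _); [rewrite /up|rewrite /down].
- by exists ((pos (h ++ trace c n) + 1) :: h).
- by exists ((pos (h ++ trace c n) - 1) :: h).
Qed.

Lemma top_trace_mono c n n' : (n <= n')%N ->
  (top (trace c n) <= top (trace c n'))%N.
Proof.
move=> /trace_suffix -/(_ c)[h ->]; elim: h => //= y h IH.
by rewrite (leq_trans IH) // leq_maxl.
Qed.

Lemma close_trace_mono c D m n n' : (n <= n')%N ->
  close D m (trace c n) -> close D m (trace c n').
Proof.
by move=> /trace_suffix -/(_ c)[h -> cl]; elim: h => //= y h IH; exact: close_cons.
Qed.

Lemma ever_trace_mono c (A : pred (seq int)) n n' : (n <= n')%N ->
  A (trace c n) -> ever A (trace c n').
Proof.
by move=> /trace_suffix -/(_ c)[h ->] /ever_here; exact: ever_catr.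
Qed.

Lemma ever_traceP c (A : pred (seq int)) n : ever A (trace c n) ->
  exists2 n', (n' <= n)%N & A (trace c n').
Proof.
elim: n => [|n IH] /=; first by rewrite orbF => ?; exists 0%N.
move=> e; have : A (trace c n.+1) || ever A (trace c n).
  by move: e => /=; case: (c n).
by case/orP => [?|/IH[n' n'n ?]]; [exists n.+1|exists n' => //; exact: leqW].
Qed.

Lemma top_trace_le c n : (top (trace c n) <= n)%N.
Proof.
elim: n => //= n IH.
by case: (c n); rewrite (leq_trans (top_cons_le _ _)).
Qed.

(** * Favorite sites read off the history *)

Section Favorites.
Variables (R : realType) (s : nat -> R) (c : nat -> bool).
Hypothesis sE : forall n, s n = (pos (trace c n))%:~R.

Lemma local_time_trace z n : local_time s z n = count_mem z (trace c n).
Proof.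
have lE n' : local_time s z n' =
    (\sum_(0 <= k < n'.+1 | (0 < k)%N && (s k == z%:~R)) 1)%N.
  by rewrite /local_time -sum1_card big_mkord.
elim: n => [|n IH]; first by rewrite lE big_mkcond big_nat1.
rewrite lE big_mkcond big_nat_recr //= -big_mkcond -lE IH sE eqr_int /=.
by case: (c n); rewrite /= addnC; case: (_ == z).
Qed.

Lemma max_local_time_trace n : max_local_time s n = top (trace c n).
Proof.
apply/eqP; rewrite eqn_leq; apply/andP; split.
  have [z <-] := max_local_time_attained s n.
  by rewrite local_time_trace count_le_top.
have [->//|] := posnP (top (trace c n)).
move=> /top_attained[z _ <-]; rewrite -local_time_trace.
exact: local_time_le_max.
Qed.

Lemma card_favorite_sites n : (0 < top (trace c n))%N ->
  #|` fset_set (favorite_sites s n)| =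
  nreach (top (trace c n)) (trace c n).
Proof.
move=> t0; rewrite nreachE //.
set h := trace c n; set r := [seq _ <- _ | _].
have -> : favorite_sites s n = [set` [fset x in r]%fset].
  apply/seteqP; rewrite /favorite_sites.
  split => z /=; rewrite local_time_trace max_local_time_trace !inE.
    rewrite -/h mem_filter mem_undup => hz; rewrite hz leqnn /=.
    by rewrite -has_pred1 has_count hz.
  by rewrite mem_filter => /andP[tz _]; apply/eqP; rewrite eqn_leq tz count_le_top.
rewrite set_fsetK card_fseq undup_id // filter_uniq //; exact: undup_uniq.
Qed.

End Favorites.

(** * The Borel-Cantelli lemma *)

Section BorelCantelli.
Variables (d : measure_display) (T : measurableType d) (R : realType)
  (P : probability T R).

Lemma ae_eventually_not (F : nat -> set T) (u : nat -> R) (B : R) :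
  (forall m, measurable (F m)) -> (forall m, P (F m) <= (u m)%:E)%E ->
  (forall n, \sum_(0 <= m < n) u m <= B) ->
  {ae P, forall w, exists m0, forall m, (m0 <= m)%N -> ~ F m w}.
Proof.
move=> mF Fu uB.
have F0 : P (lim_sup_set F) = 0%E.
  apply: lim_sup_set_cvg0 => //.
  apply: (@le_lt_trans _ _ B%:E); last exact: ltry.
  apply: lime_le; first by apply: is_cvg_nneseries => ? _ _; exact: measure_ge0.
  apply: nearW => n /=.
  apply: (@le_trans _ _ (\sum_(0 <= m < n) (u m)%:E)%E).
    by apply: lee_sum => m _.
  by rewrite sumEFin lee_fin.
exists (lim_sup_set F); split => //.
  apply: bigcap_measurable => // k _.
  by apply: bigcup_measurable => j _; exact: mF.
move=> w /= nw m0 _ /=; apply: contrapT => h.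
by apply: nw; exists m0 => m m0m Fm; apply: h; exists m.
Qed.

End BorelCantelli.

(** * Time scales of the levels *)

Section RealSequences.
Variable R : realType.

Lemma bernoulli (x : R) n : 0 <= x -> 1 + n%:R * x <= (1 + x) ^+ n.
Proof.
move=> x0; elim: n => [|n IH]; first by rewrite mul0r addr0 expr0.
have x1 : 0 <= 1 + x by rewrite addr_ge0.
rewrite exprS; apply: le_trans (ler_wpM2l x1 IH).
rewrite -natr1 -subr_ge0; set X := (X in 0 <= X).
have -> : X = n%:R * x ^+ 2 by rewrite /X; ring.
by rewrite mulr_ge0 ?exprn_ge0.
Qed.

Lemma expr_small (x e : R) : 0 <= x < 1 -> 0 < e -> exists n, x ^+ n.+1 < e.
Proof.
move=> /andP[x0 x1] e0.
have xn : `|x| < 1 by rewrite ger0_norm.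
have /cvgrPdist_lt /(_ _ e0)[n _ h] := cvg_expr xn.
exists n; have := h n.+1 (leqnSn n).
by rewrite /= sub0r normrN ger0_norm ?exprn_ge0.
Qed.

Lemma linear_le_geometric (z : R) : 1 < z ->
  exists2 K : R, 0 < K & forall m, m.+1%:R <= K * z ^+ m.
Proof.
move=> z1; have y0 : 0 < z - 1 by rewrite subr_gt0.
exists (1 + (z - 1)^-1) => [|m]; first by rewrite addr_gt0 ?invr_gt0.
have K0 : 0 <= 1 + (z - 1)^-1 by rewrite addr_ge0 ?invr_ge0 ?ltW.
have := bernoulli m (ltW y0); rewrite [1 + (z - 1)]addrC subrK => h.
apply: le_trans (ler_wpM2l K0 h).
rewrite -natr1 -subr_ge0; set X := (X in 0 <= X).
have -> : X = m%:R * (z - 1) + (z - 1)^-1 + m%:R * ((z - 1) / (z - 1) - 1).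
  by rewrite /X; ring.
by rewrite divff ?gt_eqF // subrr mulr0 addr0 addr_ge0 ?mulr_ge0 ?invr_ge0 // ltW.
Qed.

(** (1 - v)^j (1 + v)^j is at most 1, and Bernoulli gives (1 + v)^j >= j v. *)
Lemma one_sub_expr_le (v : R) j : 0 < v <= 1 -> (0 < j)%N ->
  (1 - v) ^+ j <= (j%:R * v)^-1.
Proof.
move=> /andP[v0 v1] j0.
have jv : 0 < j%:R * v by rewrite mulr_gt0 // ltr0n.
have b := bernoulli j (ltW v0).
rewrite -[leRHS]mul1r ler_pdivlMr //.
apply: (@le_trans _ _ ((1 - v) ^+ j * (1 + v) ^+ j)).
  rewrite ler_wpM2l ?exprn_ge0 ?subr_ge0 // (le_trans _ b) // lerDr //.
rewrite -exprMn; apply: exprn_ile1.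
  by rewrite mulr_ge0 ?subr_ge0 // addr_ge0 // ltW.
have -> : (1 - v) * (1 + v) = 1 - v ^+ 2 by ring.
by rewrite gerBl exprn_ge0 // ltW.
Qed.

Lemma geometric_sum_le (M x : R) n : 0 <= M -> 0 <= x < 1 ->
  \sum_(0 <= m < n) M * x ^+ m <= M / (1 - x).
Proof.
move=> M0 /andP[x0 x1]; have x1' : 0 < 1 - x by rewrite subr_gt0.
rewrite -mulr_sumr ler_wpM2l // -[leRHS]mul1r ler_pdivlMr //.
rewrite big_mkord mulrC -[1 - x]opprB mulNr -subrX1 opprB.
by rewrite gerBl exprn_ge0.
Qed.

(* Telescoping of [m^-e], since [(m+1)^(-1-e) <= (m^-e - (m+1)^-e) / e]. *)
Lemma power_sum_le (e : R) n : 0 < e ->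
  \sum_(0 <= m < n) expR (- (1 + e) * ln m%:R) <= 2 + e^-1.
Proof.
move=> e0; pose u m := expR (- (1 + e) * ln (m%:R : R)).
pose f m := expR (- e * ln (m%:R : R)).
have step m : (0 < m)%N -> u m.+1 <= (f m - f m.+1) / e.
  move=> m0; have mR : 0 < m%:R :> R by rewrite ltr0n.
  have m1R : 0 < m.+1%:R :> R by rewrite ltr0n.
  rewrite ler_pdivlMr // /u.
  have -> : - (1 + e) * ln m.+1%:R = - ln m.+1%:R + - e * ln m.+1%:R :> R by ring.
  rewrite expRD -/(f _) expRN lnK ?posrE //.
  have -> : f m = f m.+1 * expR (e * (ln m.+1%:R - ln m%:R)).
    by rewrite /f -expRD; congr expR; ring.
  rewrite -mulrA [leLHS]mulrC -mulrA -[X in _ - X]mulr1 -mulrBr ler_wpM2l ?expR_ge0 //.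
  rewrite lerBrDl; apply: le_trans (expR_ge1Dx _); rewrite lerD2l ler_pM2l //.
  (* This is ln (m + 1) - ln m >= 1 / (m + 1). *)
  have : ln (1 + - (m.+1%:R)^-1) <= - (m.+1%:R)^-1 :> R.
    apply: le_ln1Dx; rewrite ltrN2 invf_lt1 // -[1]/(1%:R) ltr_nat ltnS //.
  have -> : 1 + - m.+1%:R^-1 = m%:R / m.+1%:R :> R.
    by rewrite -[m%:R](addrK 1) natr1 mulrBl divff ?gt_eqF // mul1r.
  by rewrite ln_div ?posrE // => h; rewrite -[leLHS]opprK lerNl opprB.
have main k : \sum_(0 <= m < k.+2) u m <= 2 + (1 - f k.+1) / e.
  elim: k => [|k IH].
    (* The terms 0 and 1 both equal 1, as ln 0 = 0 by convention; hence the constant 2. *)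
    rewrite !big_nat_recr ?big_nil //= add0r /u /f ln1 ln0 // !mulr0 expR0.
    by rewrite subrr mul0r addr0.
  rewrite big_nat_recr //=; apply: le_trans (lerD IH (step k.+1 isT)) _.
  by rewrite -addrA -mulrDl addrA subrK.
have u0 m : 0 <= u m by exact: expR_ge0.
apply: (@le_trans _ _ (\sum_(0 <= m < n.+2) u m)).
  rewrite [leRHS]big_nat_recr // [X in _ <= X + _]big_nat_recr //= -addrA.
  by rewrite lerDl addr_ge0.
apply: le_trans (main n) _; rewrite lerD2l -[leRHS]mul1r ler_pM2r ?invr_gt0 //.
by rewrite gerBl expR_ge0.
Qed.

End RealSequences.

(* Two exponential time scales between which the level [m] is typically
   reached and left: [l m] is too early for it, [N m] is too late, and [N m] is
   still too early for two sites at bounded distance to reach it. *)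
Lemma time_scales (R : realType) (q : R) : 0 < q -> 2 * q < 1 ->
  exists (N l : nat -> nat) (A B K x : R),
  [/\ 1 < A, 1 < B, 1 <= K, 0 <= x < 1 & forall m,
    [/\ (N m)%:R <= K * A ^+ m, B ^+ m <= (l m).+1%:R,
      expect (1 - q) q (N m) (fun h => (top h <= m)%N%:R) [::] <= K * x ^+ m,
      expect (1 - q) q (l m) (fun h => (m <= top h)%N%:R) [::] <= K * x ^+ m &
      forall D, expect (1 - q) q (N m) (fun h => (close D m h)%:R) [::]
        <= K * D.+1%:R * x ^+ m]].
Proof.
move=> q0 q2.
have [tau [rho [C [tau1 rho1 C0 top_ge close_le]]]] := visit_bounds q0 q2.
have q20 : 0 < 2 * q by rewrite mulr_gt0.
(* Two rates with 1/(2q) < a < A < rho: about a^m blocks suffice to exceed level m, and the passage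
   from a to A absorbs the block length, linear in m. *)
pose y := (2 * q)^-1; pose a := (2 * y + rho) / 3; pose A := (y + 2 * rho) / 3.
have y1 : 1 < y by rewrite invf_gt1.
have ya : y < a by rewrite /a; move: rho1; rewrite -/y => ?; lra.
have aA : a < A by rewrite /a /A; move: rho1; rewrite -/y => ?; lra.
have Ar : A < rho by rewrite /A; move: rho1; rewrite -/y => ?; lra.
clearbody a A.
have a0 : 0 < a by lra.
have A0 : 0 < A by lra.
have rho0 : 0 < rho by lra.
have tau0 : 0 < tau by lra.
have gap : 0 < 2 * q - a^-1.
  by rewrite subr_gt0 -[2 * q]invrK ltf_pV2 ?posrE // -/y; lra.
have lam01 : 0 <= decay q < 1.
  by rewrite (ltW (decay_gt0 q0 q2)) decay_lt1.
have [L Ll] := expr_small lam01 gap.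
pose r := 2 * q - decay q ^+ L.+1.
have ra : a^-1 < r by rewrite /r ltrBrDl -ltrBrDr.
have r0 : 0 < r by apply: lt_trans ra; rewrite invr_gt0.
have r1 : r <= 1.
  rewrite /r lerBlDr (le_trans (ltW q2)) // lerDl exprn_ge0 //.
  by case/andP: lam01.
have ra1 : (r * a)^-1 < 1.
  rewrite invf_lt1 ?mulr_gt0 //.
  by move: ra; rewrite -[a^-1]mul1r ltr_pdivrMr.
have zA : 1 < A / a by rewrite ltr_pdivlMr ?mul1r.
have [K1 K10 K1le] := linear_le_geometric zA.
pose B := (1 + tau) / 2.
have B1 : 1 < B by rewrite /B; lra.
have Bt : B < tau by rewrite /B; lra.
clearbody B.
have B0 : 0 < B by lra.
pose j m := (Num.trunc (a ^+ m)).+1.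
pose N m := (j m * (m.+1 * L.+1))%N.
pose l m := Num.trunc (B ^+ m).
pose KN := 2 * K1 * L.+1%:R.
pose K := 1 + KN + r^-1 + C + KN * C.
pose x := Num.max (Num.max (r * a)^-1 (B / tau)) (A / rho).
have x1 : x < 1.
  by rewrite !gt_max ra1 !ltr_pdivrMr // !mul1r Bt Ar.
have KN0 : 0 < KN by rewrite !mulr_gt0 // ltr0n.
have rV0 : 0 < r^-1 by rewrite invr_gt0.
have KC0 : 0 < KN * C by rewrite mulr_gt0.
have ra0 : 0 <= (r * a)^-1 by rewrite invr_ge0 mulr_ge0 // ltW.
have x0 : 0 <= x by rewrite !le_max ra0.
have K_ge1 : 1 <= K by rewrite /K; lra.
have E1 n (Q : pred (seq int)) :
    expect (1 - q) q n (fun h => (Q h)%:R) [::] <= 1.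
  apply: expect_le1; [lra|exact: ltW|exact: subrK|by move=> h; case: (Q h)].
have xm (u v : R) m : 0 <= u <= x -> 0 <= v <= K -> v * u ^+ m <= K * x ^+ m.
  move=> /andP[u0 ux] /andP[v0 vK].
  by rewrite ler_pM // ?exprn_ge0 // lerXn2r.
have a1 : 1 <= a by lra.
have NA m : (N m)%:R <= KN * A ^+ m.
  rewrite /N !natrM.
  have h1 : (j m)%:R <= 2 * a ^+ m.
    have /andP[h _] := truncn_itv (exprn_ge0 m (ltW a0)).
    have := exprn_ege1 m a1; rewrite /j -natr1; lra.
  have h2 : m.+1%:R * L.+1%:R <= K1 * (A / a) ^+ m * L.+1%:R.
    by rewrite ler_wpM2r.
  apply: le_trans (ler_pM _ _ h1 h2) _; rewrite ?mulr_ge0 ?ler0n //.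
  rewrite expr_div_n /KN le_eqVlt; apply/orP; left; apply/eqP.
  by field; rewrite expf_neq0 // gt_eqF.
clearbody KN.
exists N, l, A, B, K, x; split => //.
- lra.
- by rewrite x0.
move=> m; split.
- apply: le_trans (NA m) _; rewrite ler_wpM2r ?exprn_ge0 ?(ltW A0) // /K; lra.
- by rewrite ltW // truncnS_gt.
- apply: le_trans (top_le_expect q0 q2 (L := L) m (j m) [::] (ltW r0)) _.
  rewrite -/r.
  have rm : 0 < r ^+ m.+1 <= 1 by rewrite exprn_gt0 // exprn_ile1 // ltW.
  apply: le_trans (one_sub_expr_le rm (ltn0Sn _)) _.
  apply: (@le_trans _ _ (r^-1 * (r * a)^-1 ^+ m)); last first.
    apply: xm; first by rewrite ra0 !le_max lexx.
    rewrite (ltW rV0) /= /K; lra.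
  have -> : r^-1 * (r * a)^-1 ^+ m = (a ^+ m * r ^+ m.+1)^-1.
    by rewrite exprVn exprMn exprSr !invfM; ring.
  rewrite lef_pV2 ?posrE ?mulr_gt0 ?exprn_gt0 ?ltr0n //.
  rewrite ler_wpM2r ?exprn_ge0 ?(ltW r0) //.
  by rewrite ltW // truncnS_gt.
- have [->|m0] := posnP m.
    by rewrite !expr0 mulr1; apply: le_trans (E1 _ _) K_ge1.
  apply: le_trans (top_ge _ _ m0) _.
  apply: (@le_trans _ _ (C * (B / tau) ^+ m)); last first.
    apply: xm; first by rewrite divr_ge0 ?(ltW B0) ?(ltW tau0) //= !le_max lexx orbT.
    rewrite (ltW C0) /= /K; lra.
  rewrite expr_div_n [leRHS]mulrA ler_wpM2r ?invr_ge0 ?exprn_ge0 ?(ltW tau0) //.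
  rewrite mulrC ler_wpM2l ?(ltW C0) //.
  by have /andP[] := truncn_itv (exprn_ge0 m (ltW B0)).
- move=> D; have [->|m0] := posnP m.
    rewrite !expr0 mulr1; apply: le_trans (E1 _ _) _.
    by rewrite (le_trans K_ge1) // ler_peMr ?ler1n // (le_trans ler01).
  apply: le_trans (close_le D _ _ m0) _.
  apply: (@le_trans _ _ (D%:R * (KN * C * (A / rho) ^+ m))); last first.
    rewrite [K * _]mulrC -[leRHS]mulrA; apply: ler_pM => //.
    + rewrite mulr_ge0 ?(ltW KC0) // exprn_ge0 // divr_ge0 //; exact: ltW.
    + by rewrite ler_nat.
    + apply: xm; first by rewrite divr_ge0 ?(ltW A0) ?(ltW rho0) //= !le_max lexx !orbT.
      rewrite (ltW KC0) /= /K; lra.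
  rewrite expr_div_n !mulrA ler_wpM2r ?invr_ge0 ?exprn_ge0 ?(ltW rho0) //.
  have -> : D%:R * KN * C * A ^+ m = KN * A ^+ m * C * D%:R by ring.
  by rewrite ler_wpM2r // ler_wpM2r ?(ltW C0).
Qed.

(** * Almost sure bounds *)

Section IteratedLogarithm.
Variable R : realType.

Lemma ln_nat_large (B : R) : exists n0, forall n, (n0 <= n)%N -> B <= ln n%:R.
Proof.
exists (Num.trunc (expR B)).+1 => n n0.
have n1 : expR B <= n%:R.
  by rewrite (le_trans (ltW (truncnS_gt _))) // ler_nat.
have n1' : 0 < n%:R :> R by rewrite (lt_le_trans (expR_gt0 _) n1).
by rewrite -ler_expR lnK ?posrE.
Qed.

Lemma lnln_nat_large (B : R) :
  exists n0, forall n, (n0 <= n)%N -> B <= ln (ln n%:R).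
Proof.
have [n0 h] := ln_nat_large (expR B).
exists n0 => n /h nB.
have n1' : 0 < ln n%:R :> R by rewrite (lt_le_trans (expR_gt0 _) nB).
by rewrite -ler_expR lnK ?posrE.
Qed.

End IteratedLogarithm.

Section FavoriteSites.
Variables (d : measure_display) (T : measurableType d) (R : realType)
  (P : probability T R) (q : R) (X : nat -> {RV P >-> R}).
Hypotheses (q0 : 0 < q) (q2 : 2 * q < 1) (X_indep : mutually_independent X)
  (X_id : identically_distributed X)
  (X_up : P (X 0%N @^-1` [set 1]) = (1 - q)%:E).

Local Notation E := (expect (1 - q) q).
Local Notation tr w n := (trace (coin X w) n).
Let g : R := 1 - 2 * q.
Let c0 : R := - (1 / ln g).

Let g01 : 0 < g < 1.
Proof. by have h := q0; have h' := q2; rewrite /g; lra. Qed.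
Let lng : ln g < 0. Proof. exact: ln_lt0. Qed.
Let c0_gt0 : 0 < c0.
Proof. by rewrite oppr_gt0 div1r invr_lt0. Qed.
Let lngE : ln g = - c0^-1.
Proof. by rewrite /c0 div1r invrN invrK opprK. Qed.
Let p0 : 0 <= 1 - q.
Proof. by have h := q0; have h' := q2; lra. Qed.

Let mtr (A : pred (seq int)) n : measurable [set w | A (tr w n)].
Proof. exact: measurable_trace. Qed.
Let Ptr (A : pred (seq int)) n :
  P [set w | A (tr w n)] = (E n (fun h => (A h)%:R) [::])%:E.
Proof. exact: (trace_prob erefl X_indep X_id X_up A n). Qed.

Let ae_event (A : nat -> pred (seq int)) (N : nat -> nat) (u : nat -> R) B :
  (forall m, E (N m) (fun h => (A m h)%:R) [::] <= u m) ->
  (forall n, \sum_(0 <= m < n) u m <= B) ->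
  {ae P, forall w, exists m0, forall m, (m0 <= m)%N -> ~~ A m (tr w (N m))}.
Proof.
move=> Au uB.
have := @ae_eventually_not _ _ _ P (fun m => [set w | A m (tr w (N m))]) u B.
have H1 m : measurable [set w | A m (tr w (N m))] by exact: mtr.
have H2 m : (P [set w | A m (tr w (N m))] <= (u m)%:E)%E.
  by rewrite Ptr lee_fin.
move=> /(_ H1 H2 uB); apply: filterS => w [m0 h]; exists m0 => m /h.
by move/negP.
Qed.

Lemma favorites_upper (c : R) : c0 < c ->
  {ae P, forall w, exists n0, forall n, (n0 <= n)%N ->
    (0 < top (tr w n))%N /\
    (nreach (top (tr w n)) (tr w n))%:R <= c * ln (ln n%:R)}.
Proof.
move=> cc.
have [N [l [A [B [K [x [A1 B1 K1 x01 sc]]]]]]] := time_scales q0 q2.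
(* The gap between [c'] and [c] will absorb the additive constants. *)
pose c' := (c0 + c) / 2.
have c'1 : c0 < c' by rewrite /c'; lra.
have c'2 : c' < c by rewrite /c'; lra.
clearbody c'.
have c'0 : 0 < c' by apply: lt_trans c'1.
(* Small enough that (1 + e) / c' < 1 / c0, so that [a] below exceeds [g], while a^(k m) <= m^-(1+e)
   is summable. *)
pose e := (c' / c0 - 1) / 2.
have e0 : 0 < e by rewrite /e divr_gt0 // subr_gt0 ltr_pdivlMr ?mul1r.
have ee : 1 + e < c' / c0.
  by move: e0; rewrite /e; lra.
clearbody e.
pose a := expR (- ((1 + e) / c')).
have ga : g < a.
  rewrite -[g]lnK ?posrE; last by case/andP: g01.
  rewrite ltr_expR lngE ltrN2 ltr_pdivrMr // mulrC; exact: ee.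
have [g0 g1] := andP g01.
pose b := q / (1 - q).
have b01 : 0 <= b < 1.
  have h' := q2; have p1 : 0 < 1 - q by lra.
  by rewrite divr_ge0 ?(ltW q0) //= ltr_pdivrMr // mul1r; lra.
(* b^D < (a - g) / (a + g) says g (1 + b^D) < a (1 - b^D), the condition on [a] in the upper
   potential. *)
have del : 0 < (a - g) / (a + g).
  by apply: divr_gt0; [rewrite subr_gt0|exact: addr_gt0 (lt_trans g0 ga) g0].
have [D' Db] := expr_small b01 del.
pose D := D'.+1.
have bD : b ^+ D < 1.
  by rewrite exprn_ilt1 //; case/andP: b01.
have aD : (1 - 2 * q) * ((1 + b ^+ D) / (1 - b ^+ D)) <= a.
  rewrite mulrA ler_pdivrMr ?subr_gt0 // -/g.
  move: Db; rewrite ltr_pdivlMr ?(addr_gt0 (lt_trans g0 ga) g0) // -/D => h.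
  by rewrite -subr_ge0; lra.
pose k m := (Num.trunc (c' * ln (m%:R : R))).+1.
have lnm m : 0 <= ln (m%:R : R).
  by case: m => [|m]; [rewrite ln0|rewrite ln_ge0 // ler1n].
have ak m : a ^+ k m <= expR (- (1 + e) * ln m%:R).
  rewrite /a -expRM_natl ler_expR mulrN mulNr lerN2.
  have h : c' * ln m%:R <= (k m)%:R.
    by rewrite ltW // truncnS_gt.
  rewrite [leRHS]mulrA ler_pdivlMr // [leRHS]mulrC -mulrA [_ * c']mulrC.
  by rewrite ler_wpM2l // addr_ge0 // ltW.
have K0 : 0 <= K by rewrite (le_trans ler01).
have KD0 : 0 <= K * D.+1%:R by rewrite mulr_ge0.
have geo M n : 0 <= M -> \sum_(0 <= m < n) M * x ^+ m <= M / (1 - x).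
  by move=> M0; exact: geometric_sum_le.
have F1 := @ae_event (fun m h => (top h <= m)%N) N _ _
  (fun m => let: And5 _ _ h _ _ := sc m in h) (fun n => geo K n K0).
have F2 := @ae_event (fun m h => (m <= top h)%N) l _ _
  (fun m => let: And5 _ _ _ h _ := sc m in h) (fun n => geo K n K0).
have F3 := @ae_event (close D) N _ _
  (fun m => let: And5 _ _ _ _ h := sc m in h D) (fun n => geo _ n KD0).
have sp m : E (N m) (fun h => (ever (spread_favorites D m (k m)) h)%:R) [::]
    <= expR (- (1 + e) * ln m%:R).
  have [->|m0] := posnP m.
    rewrite ln0 // mulr0 expR0; apply: expect_le1 => //; first exact: ltW.
      exact: subrK.
    by move=> h; case: ever.
  apply: le_trans (ak m).
  exact: (expect_spread_favorites q0 q2 (k m) (ltn0Sn D') m0 aD).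
have F4 := @ae_event (fun m h => ever (spread_favorites D m (k m)) h) N _ _
  sp (fun n => power_sum_le n e0).
(* The 1 comes from rounding in [k m], the other term from ln m <= ln (ln n) - ln (ln B). *)
have [n1 n1P] := lnln_nat_large ((1 - c' * ln (ln B)) / (c - c')).
apply: (filter_app3 _ _ F1 F2 F3).
move: F4; apply: filterS => w [m4 h4] [m1 h1] [m2 h2] [m3 h3].
pose m0 := maxn (maxn m1 m2) (maxn m3 m4).
have [m1m m2m] : (m1 <= m0)%N /\ (m2 <= m0)%N.
  by rewrite /m0 !leq_max !leqnn ?orbT.
have [m3m m4m] : (m3 <= m0)%N /\ (m4 <= m0)%N.
  by rewrite /m0 !leq_max !leqnn ?orbT.
exists (maxn (N m0) n1) => n; rewrite geq_max => /andP[Nn n1n].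
have topn : (m0 < top (tr w n))%N.
  apply: leq_trans (top_trace_mono _ Nn); by rewrite ltnNge h1.
set m := top (tr w n) in topn *.
(* Since m is the level at time n, that time lies between [l m] and [N m]; the events excluded at
   time [N m] are then excluded at time n by monotonicity. *)
have nN : (n < N m)%N.
  have := h1 m (leq_trans m1m (ltnW topn)); rewrite -ltnNge => h.
  rewrite ltnNge; apply: contraL h => /(top_trace_mono (coin X w)).
  by rewrite -leqNgt.
have ln' : (l m < n)%N.
  have := h2 m (leq_trans m2m (ltnW topn)); rewrite -ltnNge => h.
  rewrite ltnNge; apply: contraL h => /(top_trace_mono (coin X w)).
  by rewrite -leqNgt.
split; first exact: leq_trans topn.
have nc : ~~ close D m (tr w n).
  have := h3 m (leq_trans m3m (ltnW topn)); apply: contra.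
  exact: close_trace_mono (ltnW nN).
have Jk : (nreach m (tr w n) <= k m)%N.
  have := h4 m (leq_trans m4m (ltnW topn)); rewrite leqNgt; apply: contra => kJ.
  apply: (ever_trace_mono (ltnW nN)).
  by rewrite /spread_favorites leqnn kJ nc.
have mR : 0 < m%:R :> R by rewrite ltr0n (leq_trans _ topn).
have lnB : 0 < ln B by exact: ln_gt0.
have B0 : 0 < B by rewrite (lt_trans ltr01).
have Bn : B ^+ m <= n%:R.
  by have [_ h _ _ _] := sc m; rewrite (le_trans h) // ler_nat.
have lnn : m%:R * ln B <= ln n%:R.
  rewrite mulr_natl -lnXn // ler_ln ?posrE ?exprn_gt0 //.
  by rewrite (lt_le_trans _ Bn) // exprn_gt0.
have lnlnn : ln m%:R + ln (ln B) <= ln (ln n%:R).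
  rewrite -lnM ?posrE // ler_ln ?posrE ?mulr_gt0 //.
  by rewrite (lt_le_trans _ lnn) // mulr_gt0.
have kc : (nreach m (tr w n))%:R <= c' * ln m%:R + 1.
  apply: (@le_trans _ _ (k m)%:R); first by rewrite ler_nat.
  by rewrite /k -natr1 lerD2r truncn_le mulr_ge0 // ltW.
have := n1P n n1n; rewrite ler_pdivrMr ?subr_gt0 // => n1P'.
apply: le_trans kc _.
have : c' * (ln m%:R + ln (ln B)) <= c' * ln (ln n%:R) by rewrite ler_pM2l.
by lra.
Qed.

(** For m > 0, the largest exponent k with g^k >= 1/m. *)
Let kl (m : nat) : nat := Num.trunc (ln (m%:R : R) * c0).

Let klP m : (0 < m)%N -> m%:R^-1 <= g ^+ kl m.
Proof.
move=> m0; have mR : 0 < m%:R :> R by rewrite ltr0n.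
rewrite -[g]lnK ?posrE; last by case/andP: g01.
rewrite -expRM_natl -[m%:R]lnK ?posrE // -expRN ler_expR lngE mulrN lerN2.
rewrite ler_pdivrMr //.
by rewrite truncn_le mulr_ge0 ?(ltW c0_gt0) // ln_ge0 // ler1n.
Qed.

(** A failure up to time [N u] either passes level u without success, with probability at most l /
    u, or does not pass it, with probability at most K x^u. Both vanish as u grows. *)
Lemma many_favorites_ae (l : nat) : (0 < l)%N ->
  {ae P, forall w, exists n, many_favorites kl l (tr w n)}.
Proof.
move=> l0.
have [N [l' [A [B [K [x [A1 B1 K1 x01 sc]]]]]]] := time_scales q0 q2.
have [x0 x1] := andP x01.
have K0 : 0 < K by rewrite (lt_le_trans ltr01).
pose F := \bigcap_n [set w | ~~ ever (many_favorites kl l) (tr w n)].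
have mF : measurable F.
  by apply: bigcapT_measurable => n; exact: (mtr (fun h => ~~ ever _ h)).
exists F; split => //; last first.
  move=> w /= nw n _ /=; apply/negP => /ever_traceP[n' _ h].
  by apply: nw; exists n'.
apply/eqP; rewrite eq_le measure_ge0 andbT; apply/lee_addgt0Pr => eps eps0.
rewrite add0e.
have e2 : 0 < eps / 2 / K by rewrite !divr_gt0.
have [n xn] := expr_small x01 e2.
pose u := (maxn (maxn n.+1 l) (Num.trunc (l%:R / (eps / 2))).+1).
have lu : (l <= u)%N by rewrite /u !leq_max leqnn orbT.
have u0 : 0 < u%:R :> R by rewrite ltr0n (leq_trans l0).
pose A1' : pred (seq int) := fun h =>
  ~~ ever (many_favorites kl l) h && (u < top h)%N.
pose A2' : pred (seq int) := fun h => (top h <= u)%N.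
apply: (@le_trans _ _
  (P ([set w | A1' (tr w (N u))] `|` [set w | A2' (tr w (N u))]))).
  apply: le_measure; rewrite ?inE //.
    by apply: measurableU; exact: mtr.
  move=> w Fw /=; rewrite /A1' /A2'; case: leqP => _; [by right|left].
  by rewrite andbT; exact: Fw.
apply: (@le_trans _ _
  (P [set w | A1' (tr w (N u))] + P [set w | A2' (tr w (N u))])%E).
  exact: measureU2 (mtr A1' (N u)) (mtr A2' (N u)).
rewrite (Ptr A1' (N u)) (Ptr A2' (N u)) -EFinD lee_fin [eps]splitr; apply: lerD.
  apply: (@le_trans _ _ (l%:R / u%:R)).
    apply: (expect_no_many_favorites q0 q2 l0 lu) => i li.
    exact: klP (leq_trans l0 li).
  rewrite ler_pdivrMr // mulrC -ler_pdivrMr ?divr_gt0 //.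
  by rewrite (le_trans (ltW (truncnS_gt _))) // ler_nat /u leq_max leqnn orbT.
have [_ _ h _ _] := sc u; apply: (le_trans h).
rewrite mulrC -ler_pdivlMr // (le_trans _ (ltW xn)) //.
by apply: ler_wiXn2l => //; [exact: ltW|rewrite /u !leq_max leqnn].
Qed.

(** Successes occur at arbitrarily high levels m, at times n < [N m] <= K A^m; taking logarithms
    twice gives ln (ln n) <= ln m + [C1]. *)
Lemma favorites_lower :
  {ae P, forall w, exists C1 : R, forall l, exists n,
    [/\ (l <= top (tr w n))%N,
        c0 * ln (top (tr w n))%:R <= (nreach (top (tr w n)) (tr w n))%:R &
        ln (ln n%:R) <= ln (top (tr w n))%:R + C1]}.
Proof.
have [N [l' [A [B [K [x [A1 B1 K1 x01 sc]]]]]]] := time_scales q0 q2.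
have K0 : 0 <= K by rewrite (le_trans ler01).
have K0' : 0 < K by rewrite (lt_le_trans ltr01).
have A0 : 0 < A by rewrite (lt_trans ltr01).
have F1 := @ae_event (fun m h => (top h <= m)%N) N _ _
  (fun m => let: And5 _ _ h _ _ := sc m in h)
  (fun n => geometric_sum_le n K0 x01).
have F2 := ae_foralln (fun l => many_favorites_ae (ltn0Sn l)).
move: F1 F2; apply: filterS2 => w [m1 h1] h2.
exists (ln (ln K + ln A)) => l.
(* The 1 forces m >= 2, hence n >= 2 and ln n > 0. *)
have [n /andP[ln']] := h2 (maxn (maxn l m1) 1).
set m := top (tr w n) in ln' * => kJ.
move: ln'; rewrite !gtn_max => /andP[/andP[lm m1m] m2].
have m0 : (0 < m)%N by exact: leq_trans m2.
have mR : 0 < m%:R :> R by rewrite ltr0n.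
exists n; rewrite -/m; split; first exact: ltnW.
  rewrite mulrC (le_trans (ltW (truncnS_gt _))) // ler_nat; exact: kJ.
have nN : (n < N m)%N.
  have := h1 m (ltnW m1m); rewrite -ltnNge => h.
  rewrite ltnNge; apply: contraL h => /(top_trace_mono (coin X w)).
  by rewrite -leqNgt.
have mn : (m <= n)%N by exact: top_trace_le.
have n2 : (1 < n)%N by exact: leq_trans m2 mn.
have nR : 0 < n%:R :> R by rewrite ltr0n ltnW.
have nK : n%:R <= K * A ^+ m.
  by have [h _ _ _ _] := sc m; rewrite (le_trans _ h) // ler_nat ltnW.
have lnA : 0 < ln A by exact: ln_gt0.
have lnK' : 0 <= ln K by exact: ln_ge0.
have h3 : ln n%:R <= m%:R * (ln K + ln A).
  apply: (@le_trans _ _ (ln K + m%:R * ln A)).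
    rewrite [m%:R * _]mulr_natl -lnXn // -lnM ?posrE ?exprn_gt0 //.
    by rewrite ler_ln ?posrE // mulr_gt0 ?exprn_gt0.
  by rewrite mulrDr lerD2r ler_peMl // ler1n.
have lnn : 0 < ln (n%:R : R) by rewrite ln_gt0 // ltr1n.
by rewrite -lnM ?posrE ?ler_ln ?posrE // ?mulr_gt0 // ltr_wpDl.
Qed.

End FavoriteSites.

(** * From eventual bounds to the limit superior *)

Lemma limn_esup_le_fin (R : realType) (u : nat -> R) (c : R) n0 :
  (forall n, (n0 <= n)%N -> u n <= c) ->
  (limn_esup (fun n => (u n)%:E) <= c%:E)%E.
Proof.
move=> uc; rewrite /limn_esup /limf_esup.
apply: (@le_trans _ _ (ereal_sup ((fun n => (u n)%:E) @` [set n | (n0 <= n)%N]))).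
  apply: ereal_inf_lbound; exists [set n | (n0 <= n)%N] => //.
  by exists n0.
by apply: ge_ereal_sup => _ [n /= n0n <-]; rewrite lee_fin uc.
Qed.

Lemma limn_esup_ge_fin (R : realType) (u : nat -> R) (c : R) :
  (forall n0, exists2 n, (n0 <= n)%N & c <= u n) ->
  (c%:E <= limn_esup (fun n => (u n)%:E))%E.
Proof.
move=> uc; rewrite /limn_esup /limf_esup.
apply: le_ereal_inf_tmp => _ [V [n0 _ n0V] <-].
have [n n0n cu] := uc n0.
apply: (@le_trans _ _ (u n)%:E); first by rewrite lee_fin.
by apply: ereal_sup_ubound; exists n => //; exact: n0V.
Qed.

Lemma walk_trace (d : measure_display) (T : measurableType d) (R : realType)
    (P : probability T R) (X : nat -> {RV P >-> R}) (w : T) :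
  (forall k, X k w = 1 \/ X k w = -1) ->
  forall n, walk X w n = (pos (trace (coin X w) n))%:~R.
Proof.
move=> X1; elim=> [|n IH]; first by rewrite /walk big_ord0.
rewrite /walk big_ord_recr /= -/(walk X w n) IH /coin.
have [->|->] := X1 n; first by rewrite eqxx /= rmorphD.
by rewrite ifF ?rmorphB //; apply/eqP => h; lra.
Qed.

Lemma steps_ae (d : measure_display) (T : measurableType d) (R : realType)
    (P : probability T R) (q : R) (X : nat -> {RV P >-> R})
    (X_id : identically_distributed X)
    (X_up : P (X 0%N @^-1` [set 1]) = (1 - q)%:E)
    (X_down : P (X 0%N @^-1` [set -1]) = q%:E) :
  {ae P, forall w, forall k, X k w = 1 \/ X k w = -1}.
Proof.
apply: ae_foralln => k.
have mS (a : R) j : measurable (X j @^-1` [set a]) by exact: measurable_funPTI.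
pose S := X k @^-1` [set 1] `|` X k @^-1` [set -1].
have mSk : measurable S by exact: measurableU.
have PS : P S = 1%E.
  have -> : P S = (P (X k @^-1` [set 1%R]) + P (X k @^-1` [set (-1)%R]))%E.
    apply: measureU => //; apply/seteqP; split => w //= [-> h].
    by move/eqP: h; rewrite -subr_eq0 opprK -mulr2n pnatr_eq0.
  have e (a : R) : P (X k @^-1` [set a]) = P (X 0%N @^-1` [set a]).
    exact: (X_id k 0%N [set a]).
  by rewrite !e X_up X_down -EFinD subrK.
exists (~` S); split.
- exact: measurableC.
- by apply: etrans (probability_setC P mSk) _; rewrite PS subee.
- by move=> w /= h [h1|h1]; apply: h; [left|right].
Qed.

Theorem theorem1p2 (d : measure_display) (T : measurableType d) (R : realType)
    (P : probability T R) (p q : R) (X : nat -> {RV P >-> R})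
    (q_gt0 : 0 < q) (q_lt_half : q < 1 / 2) (pE : p = 1 - q)
    (X_indep : mutually_independent X) (X_id : identically_distributed X)
    (X_up : P (X 0%N @^-1` [set 1]) = p%:E)
    (X_down : P (X 0%N @^-1` [set -1]) = q%:E) :
  {ae P, forall w,
    limn_esup (fun n : nat =>
      ((#|` fset_set (favorite_sites (walk X w) n)|)%:R / ln (ln n%:R))%:E)
    = (- (1 / ln (1 - 2 * q)))%:E}.
Proof.
have q2 : 2 * q < 1 by lra.
rewrite pE in X_up.
set c0 := - (1 / ln (1 - 2 * q)).
have c0_gt0 : 0 < c0.
  by rewrite oppr_gt0 div1r invr_lt0 ln_lt0 //; lra.
have S := steps_ae X_id X_up X_down.
(* Countably many constants decreasing to [c0], so that one null set serves every eps. *)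
have H1 := ae_foralln (fun j : nat => favorites_upper q_gt0 q2 X_indep X_id X_up
  (c := c0 + j.+1%:R^-1) (ltac:(by rewrite ltrDl invr_gt0 ltr0n))).
have H2 := favorites_lower q_gt0 q2 X_indep X_id X_up.
apply: (filter_app2 _ _ S H1); move: H2; apply: filterS => w low S1 up'.
have sE := walk_trace S1.
have small (eps : R) : 0 < eps -> exists j : nat, j.+1%:R^-1 < eps.
  move=> e0; exists (Num.trunc eps^-1); rewrite invf_plt ?posrE ?ltr0n //.
  exact: truncnS_gt.
apply/eqP; rewrite eq_le; apply/andP; split.
  apply/lee_addgt0Pr => eps /small[j je]; rewrite -EFinD.
  have [n1 h1] := up' j.
  have [n2 h2] := lnln_nat_large (1 : R).
  apply: (@limn_esup_le_fin _ _ _ (maxn n1 n2)) => n; rewrite geq_max => /andP[n1n n2n].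
  have [tn Jn] := h1 n n1n.
  have ll : 0 < ln (ln (n%:R : R)) by rewrite (lt_le_trans ltr01) // h2.
  rewrite (card_favorite_sites sE tn) ler_pdivrMr // (le_trans Jn) //.
  by rewrite ler_wpM2r ?(ltW ll) // lerD2l ltW.
apply/lee_subgt0Pr => eps e0; rewrite -EFinB.
have [C1 h] := low.
(* Truncated at 0 so that the bound on ln (ln n) can be multiplied by [c]. *)
pose c := Num.max (c0 - eps) 0.
have cc : c < c0 by rewrite gt_max c0_gt0 andbT gtrBl.
have c_ge0 : 0 <= c by rewrite le_max lexx orbT.
apply: limn_esup_ge_fin => n0.
(* At such levels m, (c0 - c) ln m absorbs the constant c C1. *)
have [n1 h1] := ln_nat_large (c * C1 / (c0 - c)).
have [n2 h2] := lnln_nat_large (1 : R).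
have [n [ln' Jn lln]] := h (maxn (maxn n0 n1) (maxn n2 1)).
move: ln'; rewrite !geq_max => /andP[/andP[n0t n1t] /andP[n2t t0]].
have tn := top_trace_le (coin X w) n.
exists n; first exact: leq_trans n0t tn.
have ll : 0 < ln (ln (n%:R : R)).
  by rewrite (lt_le_trans ltr01) // h2 // (leq_trans n2t).
rewrite (card_favorite_sites sE t0) ler_pdivlMr //.
apply: (@le_trans _ _ (c * ln (ln n%:R))).
  by rewrite ler_wpM2r ?(ltW ll) // le_max lexx.
apply: le_trans Jn; apply: (le_trans (ler_wpM2l c_ge0 lln)).
have := h1 _ n1t; rewrite ler_pdivrMr ?subr_gt0 //.
by move=> h3; rewrite mulrDr -lerBrDl -mulrBl [leRHS]mulrC.
Qed.
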